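(* Let $n\ge1$ and let $X$ be a connected and locally connected complete metric space having the property $H(n-1,\mathbb Z)$, and let $M$ be an $F_\sigma$-subset of $X$ with $\dim M\le n-2$. Then $U\setminus M$ is arcwise connected for every open connected set $U\subset X$ with $U\setminus M\ne\varnothing$.
   Context: Homology is singular homology, reduced in dimension $0$. $X$ has the property $H(m,\mathbb Z)$ if $H_k(X,X\setminus\{x\};\mathbb Z)=0$ for all $k\le m$ and all $x\in X$. $\dim$ is covering dimension. *)

(* Defs.v *)
From HB Require Import structures.
From mathcomp Require Import all_boot all_order all_algebra.
From mathcomp Require Import all_classical all_reals all_analysis.
From Stdlib Require List.
Set Implicit Arguments. Unset Strict Implicit. Unset Printing Implicit Defensive.
Import Order.TTheory GRing.Theory Num.Theory numFieldTopology.Exports numFieldNormedType.Exports.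
Local Open Scope classical_set_scope.
Local Open Scope ring_scope.

Section Defs.
Variables (R : realType) (X : topologicalType).

Definition std_simplex (k : nat) : set 'rV[R]_(k.+1) :=
  [set t | (forall i, 0 <= t ord0 i) /\ \sum_i t ord0 i = 1].

(** Candidate singular k-simplices: maps R^(k+1) -> X; only their values on
    the standard simplex matter (see [coef]). *)
Definition simplex (k : nat) := 'rV[R]_(k.+1) -> X.

Definition singular_in (A : set X) (k : nat) (sigma : simplex k) : Prop :=
  {within @std_simplex k, continuous sigma} /\ (sigma @` (@std_simplex k)) `<=` A.

Definition chain (k : nat) := seq (int * simplex k).

Definition chain_in (A : set X) (k : nat) (c : chain k) : Prop :=
  forall p, List.In p c -> singular_in A p.2.

Definition coef (k : nat) (c : chain k) (sigma : simplex k) : int :=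
  \sum_(p <- c) (if `[< forall t, @std_simplex k t -> p.2 t = sigma t >]
                 then p.1 else 0).

Definition chain_eq (k : nat) (c d : chain k) : Prop :=
  forall sigma, coef c sigma = coef d sigma.

Definition face (k : nat) (i : 'I_(k.+2)) (t : 'rV[R]_(k.+1)) : 'rV[R]_(k.+2) :=
  \row_j (if unlift i j is Some j' then t ord0 j' else 0).

Definition boundary (k : nat) (c : chain k.+1) : chain k :=
  flatten [seq [seq (((-1) ^+ (nat_of_ord i) * p.1)%R, p.2 \o face i) | i : 'I_(k.+2) <- enum 'I_(k.+2)]
          | p <- c].

(** Relative cycle of (X, A) in degree k, for the augmented (reduced) complex:
    in degree 0 the relative cycle condition is the augmentation condition when
    A is empty (reduced homology) and vacuous otherwise. *)
Definition rel_cycle (A : set X) (k : nat) : chain k -> Prop :=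
  match k return chain k -> Prop with
  | 0 => fun c => A = set0 -> \sum_(p <- c) p.1 = 0
  | j.+1 => fun c => exists e : chain j, chain_in A e /\ chain_eq (boundary c) e
  end.

Definition rel_homology_trivial (A : set X) (k : nat) : Prop :=
  forall c : chain k, chain_in setT c -> rel_cycle A c ->
    exists (d : chain k.+1) (e : chain k),
      chain_in setT d /\ chain_in A e /\ chain_eq c (boundary d ++ e).

Definition property_H (m : nat) : Prop :=
  forall (k : nat) (x : X), (k <= m)%N -> rel_homology_trivial (~` [set x]) k.

(** Covering dimension: dim M <= m (m >= -1), for a subspace M of X.
    Relatively open sets of M are traces of open sets of X. *)
Definition covdim_le (M : set X) (m : int) : Prop :=
  forall s : seq (set X), (forall U, List.In U s -> open U) ->
    M `<=` \bigcup_(U in [set U | List.In U s]) U ->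
    exists t : seq (set X),
      (forall V, List.In V t -> open V) /\
      M `<=` \bigcup_(V in [set V | List.In V t]) V /\
      (forall V, List.In V t -> exists2 U, List.In U s & V `&` M `<=` U) /\
      (forall x, M x -> ((count (fun V => `[< V x >]) t)%:Z <= m + 1)%R).

Definition locally_connected : Prop :=
  forall (x : X) (U : set X), nbhs x U ->
    exists V : set X, [/\ open V, V x, connected V & V `<=` U].

Definition F_sigma (M : set X) : Prop :=
  exists F : nat -> set X, (forall i, closed (F i)) /\ M = \bigcup_i F i.

Definition arcwise_connected (A : set X) : Prop :=
  forall x y, A x -> A y -> x <> y ->
    exists f : R -> X,
      [/\ {within `[0, 1]%classic, continuous f},
          (forall s t, `[0, 1]%classic s -> `[0, 1]%classic t -> f s = f t -> s = t),
          f 0 = x, f 1 = y & (f @` `[0, 1]%classic) `<=` A].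

End Defs.

Definition complete_space (T : uniformType) : Prop :=
  forall F : set_system T, ProperFilter F -> cauchy F -> exists x : T, F --> x.

(* Main.v *)
(* Let F be a closed set with dim F <= n - 2. Since H_k(X, X \ {x}) = 0 for
   k <= n - 1, every relative cycle of (U, U \ F) in such a degree is a boundary
   near each point of F, and the supports being compact, finite covers of F
   suffice. The obstruction to gluing the bounding chains is a Cech class of F
   with values in cycles of one degree more; small singular chains being fine,
   this can be iterated until the Cech degree exceeds dim F. Hence
   H_1(U, U \ F) = 0, and F does not separate a path connected open set U.
   If M is the union of closed sets F_i, nested chains of small connected open
   sets, the i-th of which misses F_i, converge by completeness to a path in
   U \ M. The same construction with all F_i empty shows beforehand that open
   connected sets are path connected. Finally a path is made injective by
   collapsing a maximal open set of loops and reparametrising. *)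
Require Import Defs.
From HB Require Import structures.
From mathcomp Require Import all_boot all_order all_algebra.
From mathcomp Require Import all_classical all_reals all_analysis.
From mathcomp Require Import freeg zify ring lra.
From Stdlib Require List.
Set Implicit Arguments. Unset Strict Implicit. Unset Printing Implicit Defensive.
Import Order.TTheory GRing.Theory Num.Theory numFieldTopology.Exports numFieldNormedType.Exports.
Local Open Scope classical_set_scope.
Local Open Scope ring_scope.

(** * Free abelian groups *)

(** The numbers balance exactly. With [D = n - 1], dimension shifting starts from 1-chains in Cech
    degree 0 and takes [D] steps, which use local homology in degrees 1 to [n - 1]. It ends in Cech
    degree [D], where cochains live on [D + 1] indices, while no point of the closed set lies in
    [D + 1] distinct pieces of the cover. Two features of singular chains shape the algebra.
    Smallness is available only after subdivision, so intermediate results hold for [iter m SD] of a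
    chain, and a chain homotopy removes the subdivisions at the end. Division is impossible over the
    integers, so bounding chains chosen independently are made alternating by sorting indices, not
    by averaging. On the topological side, [U \ M] need not be open, so a clopen argument does not
    yield chains of open sets inside it. The argument runs in [W \ F_i] for one [i] at a time, while
    consecutive links are made to share points of [U \ M]; such nodes remain usable for every later
    [i]. This requires [U \ M] to be dense in [U], hence a Baire argument, whose hypothesis is again
    a consequence of non-separation. *)

Definition fab (T : Type) : zmodType := {freeg {classic T}}.

Section FreeAbelian.
Variable T : Type.
Implicit Types (c d : fab T) (x y : T) (P Q : T -> Prop).

Definition gen x : fab T := << 1 *g (x : {classic T}) >>.

Definition cf x c : int := coeff (x : {classic T}) c.

Lemma cf_is_additive x : additive (cf x).
Proof. by move=> c d; rewrite /cf coeffB. Qed.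
HB.instance Definition _ x := GRing.isAdditive.Build (fab T) int (cf x)
  (cf_is_additive x).

Lemma cfB x c d : cf x (c - d) = cf x c - cf x d.
Proof. exact: raddfB. Qed.

Lemma cf_gen x y : cf y (gen x) = `[< x = y >]%:R.
Proof.
rewrite /cf /gen coeffU mul1r.
by case: asboolP => [->|ne]; [rewrite eqxx|case: eqP].
Qed.

Lemma fabP c d : (forall x, cf x c = cf x d) -> c = d.
Proof. by move=> h; apply/eqP/freeg_eqP => x; exact: h. Qed.

Definition supp P c := forall x, cf x c != 0 -> P x.

Lemma supp0 P : supp P 0.
Proof. by move=> x; rewrite raddf0 eqxx. Qed.

Lemma suppB P c d : supp P c -> supp P d -> supp P (c - d).
Proof.
move=> hc hd x; rewrite cfB.
have [->|/hc //] := eqVneq (cf x c) 0.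
by rewrite sub0r oppr_eq0 => /hd.
Qed.

Lemma suppN P c : supp P c -> supp P (- c).
Proof. by rewrite -sub0r; apply: suppB; exact: supp0. Qed.

Lemma suppD P c d : supp P c -> supp P d -> supp P (c + d).
Proof. by move=> hc hd; rewrite -[d]opprK; apply: suppB => //; exact: suppN. Qed.

Lemma suppMz P c (n : int) : supp P c -> supp P (c *~ n).
Proof.
move=> hc x; have -> : cf x (c *~ n) = cf x c *~ n by exact: raddfMz.
by have [->|/hc //] := eqVneq (cf x c) 0; rewrite mul0rz eqxx.
Qed.

Lemma supp_sum P (I : Type) (r : seq I) (Q : pred I) (F : I -> fab T) :
  (forall i, Q i -> supp P (F i)) -> supp P (\sum_(i <- r | Q i) F i).
Proof.
by move=> h; elim/big_ind : _ => //; [exact: supp0|move=> a b; exact: suppD].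
Qed.

Lemma supp_gen P x : P x -> supp P (gen x).
Proof.
by move=> Px y; rewrite cf_gen; case: asboolP => [<-//|_]; rewrite eqxx.
Qed.

Lemma sub_supp P Q c : (forall x, P x -> Q x) -> supp P c -> supp Q c.
Proof. by move=> PQ Pc x /Pc /PQ. Qed.

Lemma suppI P Q c : supp P c -> supp Q c -> supp (fun x => P x /\ Q x) c.
Proof. by move=> Pc Qc x cx; split; [exact: Pc|exact: Qc]. Qed.

Lemma suppT c : supp (fun=> True) c.
Proof. by []. Qed.

(** Closure under differences already yields negatives, sums and integer multiples, and a chain is
    the sum of its generators weighted by coefficients. Identities between operators are thereby
    checked one simplex at a time. *)
Lemma fab_ind P (Q : fab T -> Prop) :
  Q 0 -> (forall c d, Q c -> Q d -> Q (c - d)) -> (forall x, P x -> Q (gen x)) ->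
  forall c, supp P c -> Q c.
Proof.
move=> Q0 QB Qg c Pc.
have QN d : Q d -> Q (- d) by rewrite -sub0r; exact: QB.
have QD d e : Q d -> Q e -> Q (d + e).
  by move=> hd he; rewrite -[e]opprK; apply: QB => //; exact: QN.
have QM d (n : int) : Q d -> Q (d *~ n).
  move=> hd; case: (intP n) => [|k|k]; rewrite ?mulr0z//.
    by elim: k => [|k IH]; rewrite ?mulr1z// intS mulrzDr mulr1z; exact: QD.
  rewrite mulrNz; apply: QN.
  by elim: k => [|k IH]; rewrite ?mulr1z// intS mulrzDr mulr1z; exact: QD.
have -> : c = \sum_(x <- dom c) gen x *~ cf x c.
  rewrite -[LHS]freeg_sumE; apply: eq_bigr => x _.
  by rewrite /gen freegU_mulz intz.
rewrite big_seq; elim/big_ind : _ => // x; rewrite mem_dom => cx.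
by apply: QM; apply: Qg; exact: Pc.
Qed.

Section Lin.
Variables (M : zmodType) (f : T -> M).

Definition lin c : M := fglift (f : {classic T} -> zmodule M) c.

Lemma lin_is_additive : additive lin.
Proof. exact: (lift_is_additive (f : {classic T} -> zmodule M)). Qed.
HB.instance Definition _ := GRing.isAdditive.Build (fab T) M lin lin_is_additive.

Lemma lin0 : lin 0 = 0.
Proof. exact: raddf0. Qed.

Lemma linB c d : lin (c - d) = lin c - lin d.
Proof. exact: raddfB. Qed.

Lemma linD c d : lin (c + d) = lin c + lin d.
Proof. exact: raddfD. Qed.

Lemma linMz c n : lin (c *~ n) = lin c *~ n.
Proof. exact: raddfMz. Qed.

Lemma lin_gen x : lin (gen x) = f x.
Proof. by rewrite /lin /gen liftU scale1r. Qed.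
End Lin.

Lemma eq_additive P (M : zmodType) (g h : {additive fab T -> M}) c :
  supp P c -> (forall x, P x -> g (gen x) = h (gen x)) -> g c = h c.
Proof.
move=> Pc gh; elim/(@fab_ind P) : Pc => // [|a b ea eb].
  by rewrite !raddf0.
by rewrite !raddfB ea eb.
Qed.
End FreeAbelian.

Lemma supp_lin (T U : Type) (P : T -> Prop) (Q : U -> Prop) (f : T -> fab U) c :
  (forall x, P x -> supp Q (f x)) -> supp P c -> supp Q (lin f c).
Proof.
move=> PQ Pc; elim/(@fab_ind T P) : Pc => [|a b ea eb|x Px].
- by rewrite raddf0; exact: supp0.
- by rewrite raddfB; exact: suppB.
- by rewrite lin_gen; exact: PQ.
Qed.

Lemma supp_split (T : Type) (P Q : T -> Prop) (c : fab T) :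
  supp (fun x => P x \/ Q x) c ->
  exists a b, [/\ supp P a, supp Q b & c = a + b].
Proof.
move=> h; elim/(@fab_ind T (fun x => P x \/ Q x)) : h => [|a b|x].
- by exists 0, 0; split; [exact: supp0|exact: supp0|rewrite addr0].
- move=> [a1 [a2 [h1 h2 ->]]] [b1 [b2 [k1 k2 ->]]].
  exists (a1 - b1), (a2 - b2); split; [exact: suppB|exact: suppB|].
  by rewrite opprD addrACA.
- move=> [Px|Qx].
    by exists (gen x), 0; split; [exact: supp_gen|exact: supp0|rewrite addr0].
  by exists 0, (gen x); split; [exact: supp0|exact: supp_gen|rewrite add0r].
Qed.

(** * Affine chains and barycentric subdivision *)

Notation cone v := (lin (fun l => gen (v :: l))).
Section Algebra.
Variables (R : realType) (V : lmodType R).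
Implicit Types (l : seq V) (x y : fab (seq V)) (v : V).


(* A list of points stands for the affine simplex with these vertices. The
   boundary is augmented, that of a single vertex being the empty list, so that
   bdl_cone holds in all degrees. *)
Fixpoint bdn l : fab (seq V) :=
  if l is v :: l' then gen l' - cone v (bdn l') else 0.

Local Notation bdl := (lin bdn).

Lemma bdl_gen l : bdl (gen l) = bdn l.
Proof. exact: lin_gen. Qed.

Lemma cone_gen v l : cone v (gen l) = gen (v :: l).
Proof. exact: lin_gen. Qed.

Lemma bdl_cone v x : bdl (cone v x) = x - cone v (bdl x).
Proof.
elim/(@fab_ind (seq V) (fun=> True)) : (@suppT _ x) => [|a b ea eb|l _].
- by rewrite !lin0 subr0.
- by rewrite !linB ea eb !opprD addrACA.
- by rewrite cone_gen !bdl_gen.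
Qed.

Lemma bdlK x : bdl (bdl x) = 0.
Proof.
elim/(@fab_ind (seq V) (fun=> True)) : (@suppT _ x) => [|a b ea eb|l _].
- by rewrite !lin0.
- by rewrite !linB ea eb subr0.
- rewrite bdl_gen; elim: l => [|v l IH]; first by rewrite lin0.
  by rewrite /= linB bdl_gen bdl_cone IH lin0 subr0 subrr.
Qed.

Definition bar l : V := (size l)%:R^-1 *: \sum_(v <- l) v.

(** Barycentric subdivision: cone from the barycentre over the subdivided boundary. The counter [n]
    is meant to be the number of vertices, which drops by one at each passage to the boundary. *)
Fixpoint sdn (n : nat) l : fab (seq V) :=
  if n is n'.+1 then cone (bar l) (lin (sdn n') (bdn l)) else gen l.

Local Notation sd n := (lin (sdn n)).

Lemma sd_gen n l : sd n.+1 (gen l) = cone (bar l) (sd n (bdn l)).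
Proof. exact: lin_gen. Qed.

Lemma sd0 x : sd 0 x = x.
Proof.
elim/(@fab_ind (seq V) (fun=> True)) : (@suppT _ x) => [|a b ea eb|l _].
- by rewrite !lin0.
- by rewrite !linB ea eb.
- exact: lin_gen.
Qed.

(** The standard chain homotopy between the identity and subdivision, with the same counter. *)
Fixpoint ttn (n : nat) l : fab (seq V) :=
  if n is n'.+1 then cone (bar l) (gen l - lin (ttn n') (bdn l)) else 0.

Local Notation tt n := (lin (ttn n)).

Lemma tt_gen n l : tt n.+1 (gen l) = cone (bar l) (gen l - tt n (bdn l)).
Proof. exact: lin_gen. Qed.

Lemma tt0 x : tt 0 x = 0.
Proof.
elim/(@fab_ind (seq V) (fun=> True)) : (@suppT _ x) => [|a b ea eb|l _].
- by rewrite !lin0.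
- by rewrite !linB ea eb subr0.
- exact: lin_gen.
Qed.

Definition lists (Q : V -> Prop) n l := size l = n /\ forall v, v \in l -> Q v.

Lemma lists_bdl Q n x : supp (lists Q n.+1) x -> supp (lists Q n) (bdl x).
Proof.
apply: supp_lin => l; elim: l n => [|v l IH] n [//= [sl] Ql].
have Qv : Q v by apply: Ql; rewrite mem_head.
have {}Ql u : u \in l -> Q u by move=> ul; apply: Ql; rewrite inE ul orbT.
apply: suppB; first exact: supp_gen.
case: n sl => [|n] sl; first by case: l {IH} sl {Ql} => //= _; rewrite lin0; exact: supp0.
apply: supp_lin (IH _ _); last by split; [exact: sl|].
move=> k [<- Qk]; apply: supp_gen; split=> // u.
by rewrite inE => /predU1P[->//|/Qk].
Qed.

(** Stability under barycentres suffices, since these are the only new vertices that [sd] and [tt]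
    create. *)
Definition convexP (Q : V -> Prop) :=
  forall l, l <> [::] -> (forall v, v \in l -> Q v) -> Q (bar l).

Lemma lists_cone Q n v x :
  Q v -> supp (lists Q n) x -> supp (lists Q n.+1) (cone v x).
Proof.
move=> Qv; apply: supp_lin => k [<- Qk]; apply: supp_gen; split=> // u.
by rewrite inE => /predU1P[->//|/Qk].
Qed.

Lemma lists_bar Q n l : convexP Q -> lists Q n.+1 l -> Q (bar l).
Proof. by move=> cQ [sl Ql]; apply: cQ => // l0; rewrite l0 in sl. Qed.

Lemma lists_sd Q n x : convexP Q -> supp (lists Q n) x -> supp (lists Q n) (sd n x).
Proof.
move=> cQ; elim: n x => [|n IH] x; first by rewrite sd0.
apply: supp_lin => l Ql; apply: lists_cone; first exact: lists_bar Ql.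
by apply: IH; rewrite -bdl_gen; apply: lists_bdl; exact: supp_gen.
Qed.

Lemma lists_tt Q n x : convexP Q -> supp (lists Q n) x -> supp (lists Q n.+1) (tt n x).
Proof.
move=> cQ; elim: n x => [|n IH] x; first by rewrite tt0 => _; exact: supp0.
apply: supp_lin => l Ql; apply: lists_cone; first exact: lists_bar Ql.
apply: suppB; first exact: supp_gen.
by apply: IH; rewrite -bdl_gen; apply: lists_bdl; exact: supp_gen.
Qed.

Lemma bdl_sd Q n x : supp (lists Q n.+1) x -> bdl (sd n.+1 x) = sd n (bdl x).
Proof.
move=> Qx; elim/fab_ind : Qx => [|a b ea eb|l Ql].
- by rewrite !lin0.
- by rewrite !linB ea eb.
- rewrite sd_gen bdl_cone -bdl_gen.
  (* The cone formula leaves an error term, the cone over the boundary of the subdivided boundary.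
     That it vanishes is the same assertion one degree lower, hence the inner induction. *)
  suff -> : bdl (sd n (bdl (gen l))) = 0 by rewrite lin0 subr0.
  have Ql' := lists_bdl (supp_gen Ql).
  elim: n l Ql Ql' => [|n IH] l Ql Ql'; first by rewrite sd0 bdlK.
  suff -> : bdl (sd n.+1 (bdl (gen l))) = sd n (bdl (bdl (gen l))).
    by rewrite bdlK lin0.
  elim/fab_ind : Ql' => [|a b ea eb|k Qk].
  + by rewrite !lin0.
  + by rewrite !linB ea eb.
  + have Qk' := lists_bdl (supp_gen Qk).
    by rewrite sd_gen bdl_cone -bdl_gen IH // lin0 subr0.
Qed.

Lemma bdl_tt x n : bdl (tt n.+1 x) + tt n (bdl x) = x - sd n.+1 x.
Proof.
elim: n x => [|n IH] x;
  (elim/(@fab_ind (seq V) (fun=> True)) : (@suppT _ x) => [|a b ea eb|l _];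
   [by rewrite !lin0 addr0 subr0
   |by rewrite !linB addrACA -opprD ea eb !opprD addrACA
   |]).
- by rewrite !tt_gen !tt0 subr0 bdl_cone sd_gen -bdl_gen sd0 addr0.
- rewrite tt_gen bdl_cone sd_gen -bdl_gen linB.
  have := IH (bdl (gen l)); rewrite bdlK lin0 addr0 => ->.
  by rewrite opprB addrCA subrr addr0 addrAC subrK.
Qed.
End Algebra.

Notation bdl := (lin (@bdn _ _)).
Notation sd n := (lin (@sdn _ _ n)).
Notation tt n := (lin (@ttn _ _ n)).
Notation push f := (lin (fun l => gen (map f l))).

Section Naturality.
Variables (R : realType) (V W : lmodType R) (f : V -> W).

Local Notation push := (push f).

Lemma push_gen l : push (gen l) = gen (map f l).
Proof. exact: lin_gen. Qed.

Lemma push_cone v x : push (cone v x) = cone (f v) (push x).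
Proof.
elim/(@fab_ind (seq V) (fun=> True)) : (@suppT _ x) => [|a b ea eb|l _].
- by rewrite !lin0.
- by rewrite !linB ea eb.
- by rewrite cone_gen !push_gen cone_gen.
Qed.

Lemma push_bdl x : push (bdl x) = bdl (push x).
Proof.
elim/(@fab_ind (seq V) (fun=> True)) : (@suppT _ x) => [|a b ea eb|l _].
- by rewrite !lin0.
- by rewrite !linB ea eb.
- rewrite push_gen !bdl_gen; elim: l => [|v l IH]; first by rewrite lin0.
  by rewrite /= linB push_gen push_cone IH.
Qed.

Hypothesis fbar : forall l, f (bar l) = bar (map f l).

Lemma push_sd n x : push (sd n x) = sd n (push x).
Proof.
elim: n x => [|n IH] x; first by rewrite !sd0.
elim/(@fab_ind (seq V) (fun=> True)) : (@suppT _ x) => [|a b ea eb|l _].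
- by rewrite !lin0.
- by rewrite !linB ea eb.
- by rewrite push_gen !sd_gen push_cone IH fbar -!bdl_gen push_bdl push_gen.
Qed.

Lemma push_tt n x : push (tt n x) = tt n (push x).
Proof.
elim: n x => [|n IH] x; first by rewrite !tt0 lin0.
elim/(@fab_ind (seq V) (fun=> True)) : (@suppT _ x) => [|a b ea eb|l _].
- by rewrite !lin0.
- by rewrite !linB ea eb.
- rewrite push_gen !tt_gen push_cone linB IH fbar -!bdl_gen.
  by rewrite push_bdl push_gen.
Qed.
End Naturality.

(** * Diameters under barycentric subdivision *)

Section Mesh.
Variables (R : realType) (V : normedModType R).
Implicit Types (l : seq V) (v w : V) (D : R).

Definition dia D l := forall u v, u \in l -> v \in l -> `|u - v| <= D.

Lemma bar_sub l w : l <> [::] -> bar l - w = (size l)%:R^-1 *: \sum_(v <- l) (v - w).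
Proof.
move=> l0; rewrite /bar big_split /= scalerDr; congr (_ + _).
rewrite sumrN scalerN; congr (- _).
rewrite big_const_seq count_predT iter_addr addr0 -[w *+ _]scaler_nat scalerA mulVf ?scale1r//.
by rewrite pnatr_eq0 size_eq0; apply/eqP.
Qed.

Lemma ball_convexP (w : V) D : convexP (fun v => `|v - w| <= D).
Proof.
move=> l l0 hl; rewrite bar_sub// normrZ ger0_norm ?invr_ge0//.
have sl : 0 < (size l)%:R :> R by rewrite ltr0n lt0n size_eq0; apply/eqP.
rewrite mulrC ler_pdivrMr//.
apply: (le_trans (ler_norm_sum _ _ _)).
rewrite big_seq; apply: (@le_trans _ _ (\sum_(i <- l | i \in l) D)).
  by apply: ler_sum => i il; exact: hl.
by rewrite -big_seq big_const_seq count_predT iter_addr addr0 -[D *+ _]mulr_natr.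
Qed.

(** In the mean of the differences to [v], the vertex [v] itself contributes 0, so only [size l - 1]
    of the [size l] terms count. *)
Lemma bar_dia l D v : dia D l -> v \in l ->
  `|bar l - v| <= (1 - (size l)%:R^-1) * D.
Proof.
move=> dl vl.
have l0 : l <> [::] by case: l vl {dl}.
have sl : 0 < (size l)%:R :> R by rewrite ltr0n lt0n size_eq0; apply/eqP.
rewrite bar_sub// normrZ ger0_norm ?invr_ge0//.
rewrite (perm_big _ (perm_to_rem vl)) big_cons /= subrr add0r.
rewrite mulrC ler_pdivrMr//.
apply: (le_trans (ler_norm_sum _ _ _)).
rewrite big_seq; apply: (@le_trans _ _ (\sum_(i <- rem v l | i \in rem v l) D)).
  by apply: ler_sum => i il; apply: dl => //; exact: mem_rem il.
rewrite -big_seq big_const_seq count_predT iter_addr addr0 size_rem//.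
rewrite mulrAC mulrBl mul1r mulVf ?gt_eqF// -[D *+ _]mulr_natl -subn1 natrB//.
by case: (l) vl.
Qed.

(** A pair of vertices either involves the barycentre or lies in a subdivided face. In the first
    case the face stays in a ball about the barycentre, which is convex; in the second the induction
    applies. The fixed bound [N] makes the contraction factor the same for all faces. *)
Lemma dia_sd N n D l : (n <= N)%N -> size l = n -> dia D l -> 0 <= D ->
  supp (dia ((1 - N%:R^-1) * D)) (sd n (gen l)).
Proof.
move=> nN sl dl D0.
have N1 : (1 <= N)%N -> 0 <= 1 - N%:R^-1 :> R.
  by move=> N1; rewrite subr_ge0 invf_le1 ?ltr0n// ler1n.
elim: n nN l sl dl => [|n IH] nN l sl dl.
  by rewrite sd0; apply: supp_gen; rewrite (size0nil sl).
rewrite sd_gen -bdl_gen.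
pose Q v := `|v - bar l| <= (1 - N%:R^-1) * D.
have Ql v : v \in l -> Q v.
  move=> vl; rewrite /Q distrC; apply: (le_trans (bar_dia dl vl)).
  apply: ler_wpM2r => //; rewrite lerD2l lerN2 lef_pV2 ?posrE ?ltr0n ?sl//.
  - by rewrite ler_nat.
  - exact: leq_trans nN.
have h1 : supp (lists Q n) (sd n (bdl (gen l))).
  apply: lists_sd; first exact: ball_convexP.
  by apply: lists_bdl; exact: supp_gen.
have h2 : supp (dia ((1 - N%:R^-1) * D)) (sd n (bdl (gen l))).
  have : supp (fun k => size k = n /\ dia D k) (bdl (gen l)).
    have : supp (lists (fun v => v \in l) n) (bdl (gen l)).
      by apply: lists_bdl; exact: supp_gen.
    apply: sub_supp => k [sk kl]; split=> // u v /kl ul /kl; exact: dl.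
  move=> h; elim/fab_ind : h => [|a b ea eb|k [sk dk]].
  - by rewrite lin0; exact: supp0.
  - by rewrite linB; exact: suppB.
  - by apply: IH => //; exact: ltnW.
apply: supp_lin (suppI h1 h2) => k [[_ Qk] dk]; apply: supp_gen => u v.
rewrite !inE => /predU1P[->|uk] /predU1P[->|vk].
- by rewrite subrr normr0 mulr_ge0 ?N1//; exact: leq_trans nN.
- by rewrite distrC; exact: Qk.
- exact: Qk.
- exact: dk.
Qed.
End Mesh.

(** * Affine simplices with vertices in the standard simplex *)

Section AffineSimplices.
Variable R : realType.

Lemma std_vertex k (i : 'I_k.+1) : @std_simplex R k (delta_mx ord0 i).
Proof.
split=> [j|]; first by rewrite mxE eqxx /=; case: eqP.
rewrite (bigD1 i)//= mxE !eqxx big1 ?addr0// => j ji.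
by rewrite mxE eqxx (negbTE ji).
Qed.

Lemma std_convexP k : convexP (@std_simplex R k).
Proof.
move=> l l0 hl; have sl : (size l)%:R != 0 :> R.
  by rewrite pnatr_eq0 size_eq0; apply/eqP.
split=> [i|].
  rewrite /bar mxE mulr_ge0 ?invr_ge0// summxE big_seq sumr_ge0// => v vl.
  by case: (hl _ vl).
transitivity ((size l)%:R^-1 * \sum_(v <- l) (1 : R)); last first.
  by rewrite big_const_seq count_predT iter_addr addr0 mulVf.
rewrite /bar; under eq_bigr do rewrite mxE summxE.
rewrite -mulr_sumr exchange_big/=; congr (_ * _).
by rewrite big_seq [RHS]big_seq; apply: eq_bigr => v vl; case: (hl _ vl).
Qed.

Section Aff.
Variable V : lmodType R.

Definition aff k (l : seq V) (t : 'rV[R]_k.+1) : V :=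
  \sum_(i < k.+1) t ord0 i *: l`_i.

Lemma affD k l (s t : 'rV[R]_k.+1) : aff l (s + t) = aff l s + aff l t.
Proof. by rewrite -big_split; apply: eq_bigr => i _; rewrite mxE scalerDl. Qed.

Lemma affZ k l a (t : 'rV[R]_k.+1) : aff l (a *: t) = a *: aff l t.
Proof. by rewrite scaler_sumr; apply: eq_bigr => i _; rewrite mxE scalerA. Qed.

Lemma aff0 k l : aff l (0 : 'rV[R]_k.+1) = 0.
Proof. by rewrite -(scale0r 0) affZ scale0r. Qed.

Lemma aff_sum k l (I : Type) (r : seq I) (F : I -> 'rV[R]_k.+1) :
  aff l (\sum_(i <- r) F i) = \sum_(i <- r) aff l (F i).
Proof. by apply: (big_morph _ (@affD k l)); exact: aff0. Qed.

Lemma aff_bar k l (l' : seq 'rV[R]_k.+1) : aff l (bar l') = bar (map (aff l) l').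
Proof. by rewrite /bar affZ aff_sum size_map big_map. Qed.

Definition del (i : nat) (l : seq V) := take i l ++ drop i.+1 l.

Lemma nth_del i (l : seq V) j : (del i l)`_j = l`_(bump i j).
Proof.
have [il|il] := leqP (size l) i; last first.
  rewrite nth_cat size_takel ?(ltnW il)// /bump.
  have [ji|ij] := ltnP j i; first by rewrite nth_take.
  by rewrite nth_drop; congr (_ `_ _); lia.
rewrite /del take_oversize// drop_oversize ?cats0 1?ltnW// /bump.
have [ij|//] := leqP i j.
by rewrite !nth_default ?(leq_trans il)// (leq_trans ij).
Qed.

Lemma size_del i (l : seq V) k : size l = k.+1 -> (i < k.+1)%N -> size (del i l) = k.
Proof. by move=> sl ik; rewrite size_cat size_takel ?size_drop ?sl; lia. Qed.

Lemma mem_del i (l : seq V) v : v \in del i l -> v \in l.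
Proof. by rewrite mem_cat => /orP[/mem_take|/mem_drop]. Qed.

Lemma aff_face k (l : seq V) (i : 'I_k.+2) (t : 'rV[R]_k.+1) :
  aff l (face i t) = aff (del i l) t.
Proof.
rewrite /aff (bigD1_ord i)//= mxE unlift_none scale0r add0r.
by apply: eq_bigr => j _; rewrite mxE liftK nth_del.
Qed.

(** Reconciles the recursive boundary, suited to cones, with the alternating sum over faces that
    defines the singular boundary. *)
Lemma bdn_sum (l : seq V) :
  bdn l = \sum_(i < size l) gen (del i l) *~ ((-1) ^+ i).
Proof.
elim: l => [|v l IH]; first by rewrite big_ord0.
rewrite /= big_ord_recl /= expr0 mulr1z /del take0 drop1 /=; congr (_ + _).
rewrite IH raddf_sum/= -sumrN; apply: eq_bigr => i _.
by rewrite linMz lin_gen exprS mulN1r mulrNz.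
Qed.
End Aff.

Lemma aff_aff (V : lmodType R) k n (l : seq V) (l' : seq 'rV[R]_n.+1)
    (t : 'rV[R]_k.+1) : size l' = k.+1 ->
  aff (map (aff l) l') t = aff l (aff l' t).
Proof.
move=> sl; rewrite -[RHS]/(aff l (\sum_(i < k.+1) t ord0 i *: l'`_i)) aff_sum.
apply: eq_bigr => i _.
by rewrite affZ (nth_map 0)// sl.
Qed.

Definition vertices k : seq 'rV[R]_k.+1 :=
  [seq delta_mx ord0 i | i <- enum 'I_k.+1].

Lemma size_vertices k : size (vertices k) = k.+1.
Proof. by rewrite size_map size_enum_ord. Qed.

Lemma nth_vertices k (i : 'I_k.+1) : (vertices k)`_i = delta_mx ord0 i.
Proof. by rewrite (nth_map ord0) ?size_enum_ord// nth_ord_enum. Qed.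

Lemma aff_vertices k (t : 'rV[R]_k.+1) : aff (vertices k) t = t.
Proof.
by rewrite [RHS]row_sum_delta; apply: eq_bigr => i _; rewrite nth_vertices.
Qed.

Lemma map_aff_vertices (V : lmodType R) k (l : seq V) : size l = k.+1 ->
  map (@aff V k l) (vertices k) = l.
Proof.
move=> sl; apply: (@eq_from_nth _ 0); first by rewrite size_map size_vertices.
rewrite size_map size_vertices => i ik.
rewrite (nth_map 0) ?size_vertices// (nth_vertices (Ordinal ik)) /aff.
rewrite (bigD1 (Ordinal ik))//= mxE !eqxx scale1r big1 ?addr0// => j ji.
by rewrite mxE eqxx (negbTE ji) scale0r.
Qed.

Lemma std_lists_vertices k : lists (@std_simplex R k) k.+1 (vertices k).
Proof.
split; first exact: size_vertices.
by move=> v /mapP[i _ ->]; exact: std_vertex.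
Qed.

Lemma std_aff n k (l : seq 'rV[R]_n.+1) (t : 'rV[R]_k.+1) :
  lists (@std_simplex R n) k.+1 l -> std_simplex t -> std_simplex (aff l t).
Proof.
move=> [sl hl] [t0 t1].
have hi (i : 'I_k.+1) : std_simplex l`_i by apply: hl; rewrite mem_nth ?sl.
split=> [j|].
  rewrite /aff summxE sumr_ge0// => i _; rewrite mxE mulr_ge0//.
  by case: (hi i).
rewrite /aff; under eq_bigr do rewrite summxE.
rewrite exchange_big/= -[RHS]t1; apply: eq_bigr => i _.
under eq_bigr do rewrite mxE.
by rewrite -mulr_sumr (hi i).2 mulr1.
Qed.

Lemma std_face k (i : 'I_k.+2) (t : 'rV[R]_k.+1) :
  std_simplex t -> std_simplex (face i t).
Proof.
move=> st; rewrite -[face i t]aff_vertices aff_face; apply: std_aff => //.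
split; first by rewrite (size_del _ (ltn_ord i))// size_vertices.
by move=> v /mem_del; exact: (std_lists_vertices _).2.
Qed.

Lemma aff_dist (V : normedModType R) k (l : seq V) D (t : 'rV[R]_k.+1) :
  size l = k.+1 -> dia D l -> std_simplex t -> `|aff l t - l`_0| <= D.
Proof.
move=> sl dl [t0 t1].
have -> : aff l t - l`_0 = \sum_(i < k.+1) t ord0 i *: (l`_i - l`_0).
  rewrite -[l`_0 in LHS]scale1r -t1 scaler_suml -sumrB.
  by apply: eq_bigr => i _; rewrite scalerBr.
apply: (le_trans (ler_norm_sum _ _ _)).
apply: (@le_trans _ _ (\sum_(i < k.+1) t ord0 i * D)); last first.
  by rewrite -mulr_suml t1 mul1r.
apply: ler_sum => i _; rewrite normrZ ger0_norm// ler_wpM2l//.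
by apply: dl; rewrite mem_nth ?sl.
Qed.

Lemma cvg_sum_seq (V : normedModType R) (T : Type) (F : set_system T)
    {FF : Filter F} (I : Type) (r : seq I) (f : I -> T -> V) (a : I -> V) :
  (forall i, f i @ F --> a i) ->
  (fun x => \sum_(i <- r) f i x) @ F --> \sum_(i <- r) a i.
Proof.
move=> h; elim: r => [|i r IH].
  rewrite big_nil (_ : (fun _ => _) = cst 0); first exact: cvg_cst.
  by apply/funext => x; rewrite big_nil.
rewrite big_cons (_ : (fun _ => _) = f i \+ fun x => \sum_(j <- r) f j x).
  exact: cvgD.
by apply/funext => x; rewrite big_cons.
Qed.

Lemma aff_continuous n k (l : seq 'rV[R]_n.+1) : continuous (@aff _ k l).
Proof.
move=> t; apply: (@cvg_sum_seq _ _ (nbhs t) (nbhs_filter t)) => i.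
by apply: cvgZr_tmp; exact: coord_continuous.
Qed.

Lemma std_norm k (t : 'rV[R]_k.+1) : std_simplex t -> `|t| <= 1.
Proof.
move=> [t0 t1]; rewrite [leLHS]/Num.norm/= mx_normrE.
apply: bigmax_le => // -[i j] _ /=.
by rewrite (ord1 i) ger0_norm// -t1 (bigD1 j)//= lerDl sumr_ge0.
Qed.

Lemma std_compact k : compact (@std_simplex R k).
Proof.
apply: bounded_closed_compact.
  exists 1; split; first exact: num_real.
  by move=> x x1 t /std_norm t1; exact: le_trans (ltW x1).
have -> : @std_simplex R k =
  (\bigcap_(i in [set: 'I_k.+1]) [set t | 0 <= t ord0 i]) `&`
  [set t | \sum_i t ord0 i = 1].
  by apply/seteqP; split=> t [h1 h2]; split=> // i; [move=> _; exact: h1|exact: h1 i I].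
apply: closedI.
  apply: closed_bigI => i _.
  apply: (@closed_comp _ _ (fun t : 'rV[R]_k.+1 => t ord0 i) [set x : R | 0 <= x]).
    by move=> t _; exact: coord_continuous.
  exact: closed_ge.
apply: (@closed_comp _ _ (fun t : 'rV[R]_k.+1 => \sum_i t ord0 i : R) [set x | x = 1]).
  move=> t _; apply: (@cvg_sum_seq R^o _ (nbhs t) (nbhs_filter t)) => i.
  exact: coord_continuous.
exact: closed_eq.
Qed.
End AffineSimplices.

Lemma cont_onP (T U : topologicalType) (A : set T) (f : T -> U) : {within A, continuous f} <->
  forall x, A x -> forall W, nbhs (f x) W -> nbhs x (fun y => A y -> W (f y)).
Proof. by rewrite subspace_continuousP. Qed.

Lemma cont_on_eq (T U : topologicalType) (A : set T) (f g : T -> U) : (forall x, A x -> f x = g x) ->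
  {within A, continuous f} -> {within A, continuous g}.
Proof.
move=> fg /cont_onP h; apply/cont_onP => x Ax W; rewrite -fg// => /(h _ Ax) nW.
by apply: (@filterS _ _ (nbhs_filter x) _ _ _ nW) => y hy Ay; rewrite -fg//; exact: hy.
Qed.

Lemma cont_on_comp (S T U : topologicalType) (B : set S) (A : set T) (g : S -> T) (f : T -> U) :
  {within A, continuous f} -> continuous g -> (forall x, B x -> A (g x)) ->
  {within B, continuous (f \o g)}.
Proof.
move=> /cont_onP h cg BA; apply/cont_onP => x Bx W /(h _ (BA _ Bx)) /cg nW.
by apply: (@filterS _ _ (nbhs_filter x) _ _ _ nW) => y hy By; apply: hy; exact: BA.
Qed.

(** * Singular chains *)

Section SingularChains.
Variables (R : realType) (X : topologicalType).
Local Notation simplex := (simplex R X).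
Local Notation std k := (@std_simplex R k).

(* Singular simplices only matter on the standard simplex; outside of it a
   normalised one takes its value at the first vertex. *)
Definition nrm k (s : simplex k) : simplex k :=
  fun t => if `[< std_simplex t >] then s t else s (delta_mx ord0 ord0).

Definition sgen k (s : simplex k) : fab (simplex k) := gen (nrm s).

Definition sing (A : set X) k (s : simplex k) := nrm s = s /\ singular_in A s.

Lemma nrmE k (s : simplex k) t : std_simplex t -> nrm s t = s t.
Proof. by rewrite /nrm => st; case: asboolP. Qed.

Lemma eq_nrm k (s s' : simplex k) :
  (forall t, std_simplex t -> s t = s' t) -> nrm s = nrm s'.
Proof.
move=> h; apply/funext => t; rewrite /nrm; case: asboolP => [/h//|_].
by apply: h; exact: std_vertex.
Qed.

Lemma nrmK k (s : simplex k) : nrm (nrm s) = nrm s.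
Proof. by apply: eq_nrm => t; exact: nrmE. Qed.

Lemma nrm_comp k n (s : simplex n) (g : 'rV[R]_k.+1 -> 'rV[R]_n.+1) :
  (forall t, std_simplex t -> std_simplex (g t)) -> nrm (nrm s \o g) = nrm (s \o g).
Proof. by move=> h; apply: eq_nrm => t /h; exact: nrmE. Qed.

Lemma sing_nrm A k (s : simplex k) : singular_in A s -> sing A (nrm s).
Proof.
move=> [cs sA]; split; first exact: nrmK.
split.
  by apply: cont_on_eq cs => t st; rewrite nrmE.
by move=> _ [t st <-]; rewrite nrmE//; apply: sA; exists t.
Qed.

Lemma sub_sing (A B : set X) k (s : simplex k) : A `<=` B -> sing A s -> sing B s.
Proof. by move=> AB [ns [cs sA]]; split=> //; split=> // x /sA /AB. Qed.

Lemma singI (A B : set X) k (s : simplex k) : sing A s -> sing B s -> sing (A `&` B) s.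
Proof.
move=> [ns [cs sA]] [_ [_ sB]]; split=> //; split=> // x sx.
by split; [exact: sA|exact: sB].
Qed.

Lemma sing_comp A k n (s : simplex n) (g : 'rV[R]_k.+1 -> 'rV[R]_n.+1) :
  continuous g -> (forall t, std_simplex t -> std_simplex (g t)) ->
  singular_in A s -> singular_in A (s \o g).
Proof.
move=> cg h [cs sA]; split; first exact: cont_on_comp cs cg h.
by move=> _ [t st <-]; apply: sA; exists (g t) => //; exact: h.
Qed.

Definition bds k (s : simplex k.+1) : fab (simplex k) :=
  \sum_(i < k.+2) sgen (s \o face i) *~ ((-1) ^+ i).

Definition bd k : fab (simplex k.+1) -> fab (simplex k) := lin (@bds k).

Lemma bdB k c d : @bd k (c - d) = bd c - bd d. Proof. exact: linB. Qed.
Lemma bdD k c d : @bd k (c + d) = bd c + bd d. Proof. exact: linD. Qed.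
Lemma bd0 k : @bd k 0 = 0. Proof. exact: lin0. Qed.

(** Pushes affine chains of the standard simplex forward along [s], which transfers the formulas for
    lists to singular chains. Only lists of length [k.+1] are meaningful; the support hypotheses
    below ensure this. *)
Definition Phi n k (s : simplex n) : fab (seq 'rV[R]_n.+1) -> fab (simplex k) :=
  lin (fun l => sgen (s \o aff l)).

Lemma PhiB n k (s : simplex n) c d : Phi k s (c - d) = Phi k s c - Phi k s d.
Proof. exact: linB. Qed.

Lemma PhiD n k (s : simplex n) c d : Phi k s (c + d) = Phi k s c + Phi k s d.
Proof. exact: linD. Qed.

Lemma Phi0 n k (s : simplex n) : Phi k s 0 = 0.
Proof. exact: lin0. Qed.

Lemma PhiMz n k (s : simplex n) c m : Phi k s (c *~ m) = Phi k s c *~ m.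
Proof. exact: linMz. Qed.

Lemma Phi_gen n k (s : simplex n) l : Phi k s (gen l) = sgen (s \o aff l).
Proof. exact: lin_gen. Qed.

Lemma sing_Phi A n k (s : simplex n) x : singular_in A s ->
  supp (lists (std n) k.+1) x -> supp (sing A (k:=k)) (Phi k s x).
Proof.
move=> As; apply: supp_lin => l hl; apply: supp_gen; apply: sing_nrm.
by apply: sing_comp As; [exact: aff_continuous|move=> t; exact: std_aff].
Qed.

Lemma Phi_nrm n k (s : simplex n) x : supp (lists (std n) k.+1) x ->
  Phi k (nrm s) x = Phi k s x.
Proof.
move=> hx; apply: (@eq_additive _ (lists (std n) k.+1) _
  (lin (fun l => sgen (nrm s \o aff l))) (lin (fun l => sgen (s \o aff l)))) => // l hl.
by rewrite /= !lin_gen /sgen nrm_comp// => t; exact: std_aff.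
Qed.

Lemma Phi_push n k j (s : simplex n) (l : seq 'rV[R]_n.+1) x :
  supp (lists (fun=> True) k.+1) x ->
  Phi k (s \o @aff _ _ j l) x = Phi k s (push (aff l) x).
Proof.
move=> hx; elim/fab_ind : hx => [|a b ea eb|l' [sl' _]].
- by rewrite lin0 !Phi0.
- by rewrite linB !PhiB ea eb.
- rewrite lin_gen !Phi_gen; congr sgen; apply/funext => t /=.
  by rewrite aff_aff.
Qed.

Lemma bd_sgen k (s : simplex k.+1) : bd (sgen s) = bds s.
Proof.
rewrite /bd /sgen lin_gen; apply: eq_bigr => i _; congr (_ *~ _).
by rewrite /sgen nrm_comp// => t; exact: std_face.
Qed.

Lemma bd_Phi n k (s : simplex n) x : supp (lists (std n) k.+2) x ->
  bd (Phi k.+1 s x) = Phi k s (bdl x).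
Proof.
move=> hx; elim/fab_ind : hx => [|a b ea eb|l [sl hl]].
- by rewrite lin0 !Phi0 bd0.
- by rewrite linB !PhiB bdB ea eb.
- rewrite Phi_gen bd_sgen bdl_gen bdn_sum sl [RHS]raddf_sum/=.
  apply: eq_bigr => i _; rewrite [RHS]PhiMz; congr (_ *~ _).
  rewrite Phi_gen; congr sgen; apply/funext => t /=.
  by rewrite aff_face.
Qed.

(** The identity simplex: natural operators on singular chains are determined by their value on
    it. *)
Definition simp k : fab (seq 'rV[R]_k.+1) := gen (vertices R k).

Lemma lists_simp k : supp (lists (std k) k.+1) (simp k).
Proof. by apply: supp_gen; exact: std_lists_vertices. Qed.

Lemma Phi_simp k (s : simplex k) : Phi k s (simp k) = sgen s.
Proof. by rewrite Phi_gen; congr sgen; apply/funext => t /=; rewrite aff_vertices. Qed.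

Lemma lists_weak k (V : lmodType R) (P Q : V -> Prop) x :
  (forall v, P v -> Q v) -> supp (lists P k) x -> supp (lists Q k) x.
Proof. by move=> PQ; apply: sub_supp => l [sl hl]; split=> // v /hl /PQ. Qed.

Lemma sing_bd A k c : supp (sing A (k:=k.+1)) c -> supp (sing A (k:=k)) (bd c).
Proof.
apply: supp_lin => s [ns As]; rewrite -bd_sgen -Phi_simp bd_Phi; last exact: lists_simp.
by apply: sing_Phi => //; apply: lists_bdl; exact: lists_simp.
Qed.

Lemma bdK k (c : fab (simplex k.+2)) : bd (bd c) = 0.
Proof.
elim/(@fab_ind (simplex k.+2) (fun=> True)) : (@suppT _ c) => [|a b ea eb|s _].
- by rewrite !bd0.
- by rewrite !bdB ea eb subr0.
- rewrite /(bd (gen s)) lin_gen -bd_sgen -Phi_simp bd_Phi; last exact: lists_simp.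
  rewrite bd_Phi; last by apply: lists_bdl; exact: lists_simp.
  by rewrite bdlK Phi0.
Qed.

Definition SD k : fab (simplex k) -> fab (simplex k) :=
  lin (fun s => Phi k s (sd k.+1 (simp k))).

Definition TT k : fab (simplex k) -> fab (simplex k.+1) :=
  lin (fun s => Phi k.+1 s (tt k.+1 (simp k))).

Lemma SDB k c d : @SD k (c - d) = SD c - SD d. Proof. exact: linB. Qed.
Lemma SD0 k : @SD k 0 = 0. Proof. exact: lin0. Qed.
Lemma TTB k c d : @TT k (c - d) = TT c - TT d. Proof. exact: linB. Qed.
Lemma TT0 k : @TT k 0 = 0. Proof. exact: lin0. Qed.

Lemma lists_sd_simp k : supp (lists (std k) k.+1) (sd k.+1 (simp k)).
Proof. by apply: lists_sd; [exact: std_convexP|exact: lists_simp]. Qed.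

Lemma lists_tt_simp k : supp (lists (std k) k.+2) (tt k.+1 (simp k)).
Proof. by apply: lists_tt; [exact: std_convexP|exact: lists_simp]. Qed.

(** Naturality: [aff l] preserves barycentres and carries the standard vertices to [l], so it
    carries the subdivision of the identity simplex to that of [l]. *)
Lemma SD_Phi n k (s : simplex n) x : supp (lists (std n) k.+1) x ->
  SD (Phi k s x) = Phi k s (sd k.+1 x).
Proof.
move=> hx; elim/fab_ind : hx => [|a b ea eb|l [sl hl]].
- by rewrite lin0 !Phi0 SD0.
- by rewrite linB !PhiB SDB ea eb.
- rewrite Phi_gen /SD /sgen lin_gen Phi_nrm; last exact: lists_sd_simp.
  rewrite Phi_push; last by apply: (lists_weak _ (@lists_sd_simp k)).
  rewrite push_sd; last by move=> l'; exact: aff_bar.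
  by rewrite /simp (lin_gen (fun l' => gen (map (aff l) l'))) map_aff_vertices.
Qed.

Lemma TT_Phi n k (s : simplex n) x : supp (lists (std n) k.+1) x ->
  TT (Phi k s x) = Phi k.+1 s (tt k.+1 x).
Proof.
move=> hx; elim/fab_ind : hx => [|a b ea eb|l [sl hl]].
- by rewrite lin0 !Phi0 TT0.
- by rewrite linB !PhiB TTB ea eb.
- rewrite Phi_gen /TT /sgen lin_gen Phi_nrm; last exact: lists_tt_simp.
  rewrite Phi_push; last by apply: (lists_weak _ (@lists_tt_simp k)).
  rewrite push_tt; last by move=> l'; exact: aff_bar.
  by rewrite /simp (lin_gen (fun l' => gen (map (aff l) l'))) map_aff_vertices.
Qed.

Lemma SD_sgen k (s : simplex k) : SD (sgen s) = Phi k s (sd k.+1 (simp k)).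
Proof. by rewrite -[sgen s]Phi_simp SD_Phi//; exact: lists_simp. Qed.

Lemma TT_sgen k (s : simplex k) : TT (sgen s) = Phi k.+1 s (tt k.+1 (simp k)).
Proof. by rewrite -[sgen s]Phi_simp TT_Phi//; exact: lists_simp. Qed.

Lemma sing_sgen A k (s : simplex k) : sing A s -> gen s = sgen s.
Proof. by move=> [ns _]; rewrite /sgen ns. Qed.

Lemma sing_SD A k c : supp (sing A (k:=k)) c -> supp (sing A (k:=k)) (SD c).
Proof. by apply: supp_lin => s [_ As]; apply: sing_Phi => //; exact: lists_sd_simp. Qed.

Lemma sing_TT A k c : supp (sing A (k:=k)) c -> supp (sing A (k:=k.+1)) (TT c).
Proof. by apply: supp_lin => s [_ As]; apply: sing_Phi => //; exact: lists_tt_simp. Qed.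

Lemma bd_SD A k c : supp (sing A (k:=k.+1)) c -> bd (SD c) = SD (bd c).
Proof.
move=> hc; elim/fab_ind : hc => [|a b ea eb|s As].
- by rewrite !(SD0, bd0).
- by rewrite !(SDB, bdB) ea eb.
- rewrite (sing_sgen As) SD_sgen bd_Phi; last exact: lists_sd_simp.
  rewrite (bdl_sd (@lists_simp k.+1)) -[sgen s]Phi_simp bd_Phi; last exact: lists_simp.
  by rewrite SD_Phi//; apply: lists_bdl; exact: lists_simp.
Qed.

Lemma bd_TT A k c : supp (sing A (k:=k.+1)) c ->
  bd (TT c) + TT (bd c) = c - SD c.
Proof.
move=> hc; elim/fab_ind : hc => [|a b ea eb|s As].
- by rewrite !(SD0, TT0, bd0) addr0 subr0.
- by rewrite !(SDB, TTB, bdB) addrACA -opprD ea eb !opprD addrACA.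
- rewrite (sing_sgen As) SD_sgen TT_sgen bd_Phi; last exact: lists_tt_simp.
  rewrite -[sgen s]Phi_simp bd_Phi; last exact: lists_simp.
  rewrite TT_Phi; last by apply: lists_bdl; exact: lists_simp.
  by rewrite -PhiB -bdl_tt PhiD.
Qed.
End SingularChains.

(** * Lebesgue numbers and iterated subdivision *)

Section SmallChains.
Variables (R : realType) (X : topologicalType).
Local Notation simplex := (simplex R X).
Local Notation std k := (@std_simplex R k).

Lemma lebesgue_number k (s : simplex k) (I : Type) (O : I -> set X) :
  {within std k, continuous s} ->
  (forall t, std_simplex t -> exists i, nbhs (s t) (O i)) ->
  exists2 e : R, 0 < e & forall v, std_simplex v ->
    exists i, forall w, std_simplex w -> `|w - v| <= e -> O i (s w).
Proof.
move=> /cont_onP cs hO.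
pose P (e : R) (v : 'rV[R]_k.+1) := exists i, forall w, std_simplex w ->
  `|w - v| <= e -> O i (s w).
(* Compactness in its near-covering form, with radii tending to 0 from the right: radii that work
   locally yield one radius for the whole simplex. *)
have /compact_near_coveringP/(_ R (0 : R)^'+ P) := @std_compact R k.
move=> /(_ _)[].
  move=> x sx; have [i /(cs _ sx)] := hO _ sx.
  rewrite -nbhs_ballE => -[e /= e0 xe].
  exists (ball x (e / 2), [set d | d < e / 2]); first split.
  - by apply: nbhsx_ballx; exact: divr_gt0.
  - by apply: nbhs_right_lt; exact: divr_gt0.
  move=> [v d] [/= xv de] ; exists i => w sw wv; apply: xe => //.
  rewrite /= -ball_normE /= in xv *; rewrite (splitr e).
  rewrite -(subrKA v); apply: le_lt_trans (ler_normD _ _) _.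
  by apply: ltrD => //; rewrite distrC; exact: le_lt_trans de.
move=> e /= e0 hP; exists (e / 2); first exact: divr_gt0.
move=> v sv; apply: hP => //=; last exact: divr_gt0.
by rewrite sub0r normrN gtr0_norm ?divr_gt0// gtr_pMr// invf_lt1// ltr1n.
Qed.

(** The factor 2 bounds the initial diameter, since points of the standard simplex have norm at most
    1. *)
Lemma supp_iter_sd k m : supp (fun l => lists (std k) k.+1 l /\
    dia ((1 - k.+1%:R^-1) ^+ m * 2) l) (iter m (sd k.+1) (simp R k)).
Proof.
have N0 : 0 <= 1 - k.+1%:R^-1 :> R.
  by rewrite subr_ge0 invf_le1 ?ltr0n// ler1n.
elim: m => [|m IH].
  apply: supp_gen; rewrite expr0 mul1r; split; first exact: std_lists_vertices.
  move=> u v /(std_lists_vertices _ _).2 /std_norm u1.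
  move=> /(std_lists_vertices _ _).2 /std_norm v1.
  by apply: le_trans (ler_normB _ _) _; rewrite -[2]/(1 + 1); exact: lerD.
rewrite iterS; apply: supp_lin IH => l [[sl hl] dl] l' l'l; split.
  have : supp (lists (std k) k.+1) (sd k.+1 (gen l)).
    by apply: lists_sd; [exact: std_convexP|exact: supp_gen].
  by apply; rewrite lin_gen.
have : supp (dia ((1 - k.+1%:R^-1) * ((1 - k.+1%:R^-1) ^+ m * 2))) (sd k.+1 (gen l)).
  by apply: dia_sd => //; rewrite mulr_ge0// exprn_ge0.
by rewrite exprS -mulrA; apply; rewrite lin_gen.
Qed.

Lemma iter_SD_Phi n k (s : simplex n) m x : supp (lists (std n) k.+1) x ->
  iter m (@SD R X k) (Phi k s x) = Phi k s (iter m (sd k.+1) x).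
Proof.
move=> hx; suff [//] : iter m (@SD R X k) (Phi k s x) = Phi k s (iter m (sd k.+1) x) /\
  supp (lists (std n) k.+1) (iter m (sd k.+1) x).
elim: m => [//|m [IH1 IH2]]; rewrite !iterS IH1 SD_Phi//; split=> //.
by apply: lists_sd => //; exact: std_convexP.
Qed.

Lemma iter_SDB k m (c d : fab (simplex k)) :
  iter m (@SD R X k) (c - d) = iter m (@SD R X k) c - iter m (@SD R X k) d.
Proof. by elim: m => // m IH; rewrite !iterS IH SDB. Qed.

Lemma iter_SD0 k m : iter m (@SD R X k) 0 = 0.
Proof. by elim: m => // m IH; rewrite !iterS IH SD0. Qed.

Lemma sing_iter_SD A k m c :
  supp (sing A (k:=k)) c -> supp (sing A (k:=k)) (iter m (@SD R X k) c).
Proof. by move=> hc; elim: m => // m IH; rewrite iterS; exact: sing_SD. Qed.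

Lemma bd_iter_SD A k m c : supp (sing A (k:=k.+1)) c ->
  bd (iter m (@SD R X k.+1) c) = iter m (@SD R X k) (bd c).
Proof.
move=> hc; elim: m => // m IH; rewrite !iterS -IH (bd_SD (A:=A))//.
exact: sing_iter_SD.
Qed.

(** The conclusion covers all large [m], not just one, so that finitely many chains can be
    subdivided equally often. *)
Lemma small_chain k (I : Type) (O : I -> set X) c :
  supp (fun s => sing setT s /\
    forall t, std_simplex t -> exists i, nbhs (s t) (O i)) c ->
  exists m0, forall m, (m0 <= m)%N ->
    supp (fun s => exists i, sing (O i) s) (iter m (@SD R X k) c).
Proof.
move=> hc; elim/fab_ind : hc => [|a b [m ha] [n hb]|s [sT hO]].
- by exists 0%N => m _; rewrite iter_SD0; exact: supp0.
- exists (maxn m n) => j; rewrite geq_max => /andP[mj nj].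
  by rewrite iter_SDB; apply: suppB; [exact: ha|exact: hb].
- have [ns [cs _]] := sT.
  have [e e0 he] := lebesgue_number cs hO.
  have r1 : `|1 - k.+1%:R^-1 : R| < 1.
    rewrite ger0_norm; first by rewrite gtrBl invr_gt0 ltr0n.
    by rewrite subr_ge0 invf_le1 ?ltr0n// ler1n.
  (* Half of [e] is taken because the mesh after [m] subdivisions is bounded by twice the [m]-th
     power. *)
  have /cvgrPdist_le/(_ _ (divr_gt0 e0 (@ltr0Sn R 1))) := cvg_expr r1.
  move=> [m0 _ hm0]; exists m0 => m /hm0 /=.
  rewrite sub0r normrN => hm.
  rewrite (sing_sgen sT) -[sgen s]Phi_simp iter_SD_Phi; last exact: lists_simp.
  apply: supp_lin (@supp_iter_sd k m) => l [[sl hl] dl]; apply: supp_gen.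
  have [|i hi] := he l`_0; first by apply: hl; rewrite mem_nth ?sl.
  exists i; apply: sing_nrm; split.
    by apply: cont_on_comp cs _ _; [exact: aff_continuous|move=> t; exact: std_aff].
  move=> _ [t st <-]; apply: hi; first exact: std_aff.
  apply: le_trans (aff_dist sl dl st) _.
  by rewrite -ler_pdivlMr//; apply: le_trans hm; exact: ler_norm.
Qed.
End SmallChains.

(** * Comparison with the chains of the statement *)

Section Chains.
Variables (R : realType) (X : topologicalType).
Local Notation simplex := (simplex R X).

Definition fab_of k (c : chain R X k) : fab (simplex k) :=
  \sum_(p <- c) sgen p.2 *~ p.1.

Lemma cf_fab_of k (c : chain R X k) s : cf (nrm s) (fab_of c) = coef c s.
Proof.
rewrite /fab_of [LHS]raddf_sum; apply: eq_bigr => -[n s'] _ /=.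
have -> : cf (nrm s) (sgen s' *~ n) = cf (nrm s) (sgen s') *~ n by exact: raddfMz.
rewrite cf_gen; case: asboolP => e; case: asboolP => e'.
- by rewrite intz.
- by case: e' => t st; rewrite -(nrmE s' st) e nrmE.
- by case: e; exact: eq_nrm.
- by rewrite mul0rz.
Qed.

Lemma supp_fab_of A k (c : chain R X k) :
  chain_in A c -> supp (sing A (k:=k)) (fab_of c).
Proof.
elim: c => [|p c IH] h; first by rewrite /fab_of big_nil; exact: supp0.
rewrite /fab_of big_cons; apply: suppD.
  by apply: suppMz; apply: supp_gen; apply: sing_nrm; apply: h; left.
by apply: IH => q qc; apply: h; right.
Qed.

(** [coef] does not distinguish simplices that agree on the standard simplex. Since [fab_of]
    involves normalised simplices only, and each class has exactly one of these, no information is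
    lost or added. *)
Lemma chain_eqP k (c d : chain R X k) : chain_eq c d <-> fab_of c = fab_of d.
Proof.
split=> [h|h s]; last by rewrite -!cf_fab_of h.
have hn (e : chain R X k) : supp (fun s => nrm s = s) (fab_of e).
  by apply: supp_sum => p _; apply: suppMz; apply: supp_gen; exact: nrmK.
apply: fabP => s; have [ns|ns] := EM (nrm s = s).
  by rewrite -ns !cf_fab_of.
have hz (e : chain R X k) : cf s (fab_of e) = 0.
  by apply/eqP/negPn/negP => /(hn e)/ns.
by rewrite !hz.
Qed.

Lemma fab_of_cat k (c d : chain R X k) : fab_of (c ++ d) = fab_of c + fab_of d.
Proof. exact: big_cat. Qed.

Lemma fab_of_boundary k (c : chain R X k.+1) : fab_of (boundary c) = bd (fab_of c).
Proof.
elim: c => [|p c IH]; first by rewrite /fab_of /boundary/= !big_nil bd0.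
rewrite [boundary _]/= fab_of_cat -/(boundary c) IH /fab_of [in RHS]big_cons bdD.
congr (_ + _); rewrite big_map big_enum/= /bd linMz -/(bd _) bd_sgen /bds.
rewrite mulrz_suml; apply: eq_bigr => i _.
by rewrite /= -mulrzA mulrC.
Qed.

Lemma fab_of_surj A k (c : fab (simplex k)) : supp (sing A (k:=k)) c ->
  exists2 d : chain R X k, chain_in A d & fab_of d = c.
Proof.
move=> hc; elim/fab_ind : hc => [|a b [d hd <-] [e he <-]|s hs].
- by exists [::] => //; rewrite /fab_of big_nil.
- exists (d ++ [seq (- p.1, p.2) | p <- e]).
    move=> p pde; have [/hd//|pe] := List.in_app_or _ _ _ pde.
    suff [q qe ->] : exists2 q, List.In q e & p = (- q.1, q.2) by exact: (he q qe).
    elim: e {he pde} pe => //= q e IH [<-|/IH[r re ->]]; first by exists q => //; left.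
    by exists r => //; right.
  rewrite fab_of_cat; congr (_ + _); rewrite /fab_of big_map -sumrN.
  by apply: eq_bigr => p _; rewrite mulrNz.
- exists [:: (1, s)]; first by move=> _ [<-|[]] /=; case: hs.
  by rewrite /fab_of big_seq1 mulr1z -(sing_sgen hs).
Qed.

Lemma property_H_kill n j x (z : fab (simplex j.+1)) :
  property_H R X n -> (j.+1 <= n)%N ->
  supp (sing setT (k:=j.+1)) z -> supp (sing (~` [set x]) (k:=j)) (bd z) ->
  exists2 y, supp (sing setT (k:=j.+2)) y &
             supp (sing (~` [set x]) (k:=j.+1)) (z - bd y).
Proof.
move=> hH jn /fab_of_surj[c hc <-] hz.
have [|d [e [hd [he /chain_eqP]]]] := hH _ x jn c hc.
  have [e he ez] := fab_of_surj hz.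
  by exists e; split=> //; apply/chain_eqP; rewrite fab_of_boundary.
rewrite fab_of_cat fab_of_boundary => ->.
exists (fab_of d); first exact: supp_fab_of.
by rewrite addrAC subrr add0r; exact: supp_fab_of.
Qed.
End Chains.

(** * Alternating cochains *)

Section Cochains.
Variables (I : eqType) (G : zmodType).
Implicit Types (u v : seq I -> G) (s t : seq I).

(** The Cech coboundary; unfolding the recursion gives the alternating sum over omitted indices.
    Cochains of all degrees are stored in one function on lists. *)
Fixpoint dl u s : G := if s is i :: s' then u s' - dl (fun t => u (i :: t)) s' else 0.

Lemma dlB u v s : dl (fun t => u t - v t) s = dl u s - dl v s.
Proof.
elim: s u v => [|i s IH] u v /=; first by rewrite subr0.
by rewrite IH !opprD addrACA.
Qed.

Lemma dl_sum (J : Type) (r : seq J) (f : J -> seq I -> G) s :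
  dl (fun t => \sum_(j <- r) f j t) s = \sum_(j <- r) dl (f j) s.
Proof.
elim: s f => [|i s IH] f /=; first by rewrite big1.
by rewrite (IH (fun j t => f j (i :: t))) -sumrB.
Qed.

Lemma dlK u s : dl (dl u) s = 0.
Proof. by elim: s u => //= i s IH u; rewrite dlB IH subr0 subrr. Qed.

Lemma eq_dl u v s : (forall t, (size t).+1 = size s -> u t = v t) -> dl u s = dl v s.
Proof.
elim: s u v => //= i s IH u v h; rewrite h//; congr (_ - _).
by apply: IH => t ts; apply: h; rewrite /= ts.
Qed.

Lemma dl_closed (Q : G -> Prop) u s : (forall x y, Q x -> Q y -> Q (x - y)) ->
  Q 0 -> (forall t, (size t).+1 = size s -> {subset t <= s} -> Q (u t)) ->
  Q (dl u s).
Proof.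
move=> QB Q0; elim: s u => //= i s IH u h; apply: QB.
  by apply: h => // j js; rewrite inE js orbT.
apply: IH => t ts tsub; apply: h => /=; first by rewrite ts.
by move=> j; rewrite !inE => /predU1P[->|/tsub->]; rewrite ?eqxx ?orbT.
Qed.

(** The second clause is separate because [G] may have 2-torsion. *)
Definition alternated u :=
  (forall r a b s, u (r ++ a :: b :: s) = - u (r ++ b :: a :: s)) /\
  (forall r a s, u (r ++ a :: a :: s) = 0).

Lemma alternated_cons u i : alternated u -> alternated (fun t => u (i :: t)).
Proof. by move=> [h1 h2]; split=> r *; [exact: (h1 (i :: r))|exact: (h2 (i :: r))]. Qed.

Lemma alternated_dl u : alternated u -> alternated (dl u).
Proof.
move=> au; split=> r.
  move=> a b s; elim: r u au => [|i r IH] u au /=.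
    have h := au.1 [::] a b; rewrite /= in h.
    rewrite (_ : dl _ s = - dl (fun t => u (b :: a :: t)) s).
      by rewrite !opprB addrA.
    rewrite -[RHS]add0r -[X in X - _](_ : dl (fun=> 0 : G) s = 0).
      by rewrite -dlB; apply: eq_dl => t _; rewrite h sub0r.
    by apply: (@dl_closed (eq^~ 0)) => // x y -> ->; rewrite subr0.
  rewrite (au.1 r a b s) (IH (fun t => u (i :: t))) ?opprD//.
  exact: alternated_cons.
move=> a s; elim: r u au => [|i r IH] u au /=.
  rewrite opprB addrCA subrr addr0.
  by apply: (@dl_closed (eq^~ 0)) => // [x y -> ->|t _ _]; rewrite ?subr0// (au.2 [::]).
by rewrite (au.2 r a s) (IH (fun t => u (i :: t))) ?subr0//; exact: alternated_cons.
Qed.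

Lemma alternatedB u v : alternated u -> alternated v ->
  alternated (fun t => u t - v t).
Proof.
move=> [u1 u2] [v1 v2]; split=> r *; last by rewrite u2 v2 subr0.
by rewrite u1 v1 opprB opprK addrC.
Qed.
End Cochains.

Lemma dl_additive (I : eqType) (G H : zmodType) (f : G -> H) (u : seq I -> G) s :
  f 0 = 0 -> (forall x y, f (x - y) = f x - f y) ->
  dl (fun t => f (u t)) s = f (dl u s).
Proof. by move=> f0 fB; elim: s u => //= i s IH u; rewrite IH fB. Qed.

Lemma alternated_additive (I : eqType) (G H : zmodType) (f : G -> H) (u : seq I -> G) :
  f 0 = 0 -> (forall x y, f (x - y) = f x - f y) ->
  alternated u -> alternated (fun t => f (u t)).
Proof.
move=> f0 fB [u1 u2]; split=> r *; last by rewrite u2.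
by rewrite u1 -sub0r fB f0 sub0r.
Qed.

Lemma dl_map (I J : eqType) (G : zmodType) (r : I -> J) (u : seq J -> G) s :
  dl (fun t => u (map r t)) s = dl u (map r s).
Proof. by elim: s u => //= i s IH u; rewrite (IH (fun t => u (r i :: t))). Qed.

Lemma alternated_map (I J : eqType) (G : zmodType) (f : I -> J) (u : seq J -> G) :
  alternated u -> alternated (fun t => u (map f t)).
Proof. by move=> [u1 u2]; split=> r *; rewrite !map_cat /=; [exact: u1|exact: u2]. Qed.

(** The order of a cover limits distinct indices only; this disposes of lists with repetitions. *)
Lemma alternated_uniq (I : eqType) (G : zmodType) (u : seq I -> G) s :
  alternated u -> ~~ uniq s -> u s = 0.
Proof.
have h (t : seq I) (a : I) v : alternated v -> a \in t -> v (a :: t) = 0.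
  elim: t v => // b t IH v av; rewrite inE => /predU1P[<-|ta].
    exact: (av.2 [::]).
  rewrite (av.1 [::]) /= (IH (fun t => v (b :: t)))//; first by rewrite oppr0.
  exact: alternated_cons.
elim: s u => // i s IH u au /=; rewrite negb_and negbK => /orP[/h->//|/IH].
by move=> /(_ (fun t => u (i :: t))); apply; exact: alternated_cons.
Qed.

(** * Antisymmetrisation without division *)

Section Alternation.
Variables (N : nat) (G : zmodType).
Implicit Types (u v : seq 'I_N -> G) (s t : seq 'I_N) (a b : 'I_N).

(* Read u at the list obtained by inserting a in order into s, with the sign
   of that insertion, and 0 if a already occurs. *)
Fixpoint insop u a s : G :=
  if s is b :: s' then
    if (a < b)%N then u (a :: b :: s')
    else if (b < a)%N then - insop (fun t => u (b :: t)) a s' else 0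
  else u [:: a].

(** The value of [u] at the sorted rearrangement of [s], with the sign of the sorting permutation,
    and 0 in the presence of a repetition. It fixes alternating cochains, whereas summing over all
    permutations would multiply them by a factorial. *)
Fixpoint altop u s : G := if s is a :: s' then altop (insop u a) s' else u [::].

Lemma insop0 a s : insop (fun=> 0) a s = 0.
Proof. by elim: s => //= b s IH; rewrite IH oppr0; case: ifP => //; case: ifP. Qed.

Lemma insopN u a s : insop (fun t => - u t) a s = - insop u a s.
Proof.
elim: s u => //= b s IH u; rewrite IH; case: ifP => //; case: ifP => //.
by rewrite oppr0.
Qed.

Lemma altopN u s : altop (fun t => - u t) s = - altop u s.
Proof.
elim: s u => //= a s IH u; rewrite -IH; congr (altop _ s).
by apply/funext => t; exact: insopN.
Qed.

Lemma altop0 s : altop (fun=> 0) s = 0.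
Proof.
elim: s => //= a s IH; rewrite -[RHS]IH; congr (altop _ s).
by apply/funext => t; exact: insop0.
Qed.

Lemma insop_swap u a b s : insop (insop u a) b s = - insop (insop u b) a s.
Proof.
elim: s u => [|c s IH] u /=.
  by case: ltngtP; rewrite ?opprK ?oppr0.
case: (ltngtP b c) => bc; case: (ltngtP a c) => ac; case: (ltngtP a b) => ab //=;
  try lia; rewrite ?insopN ?insop0 ?opprK ?oppr0 //.
all: try by rewrite ?insopN IH ?opprK.
all: try by move: ab; rewrite ?(val_inj ac) ?(val_inj bc) ?ltnn.
Qed.

Lemma alternated_altop u : alternated (altop u).
Proof.
have swap v a b s : altop v (a :: b :: s) = - altop v (b :: a :: s).
  rewrite /= -altopN; congr (altop _ s); apply/funext => t.
  exact: insop_swap.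
split=> r a; last first.
  move=> s; elim: r u => [|i r IH] u /=; last exact: IH.
  rewrite -[RHS](altop0 s); congr (altop _ s); apply/funext => t.
  elim: t u => [|c t IH] u /=; first by rewrite ltnn.
  case: (ltngtP a c) => //= ac; first by rewrite ltnn.
  by rewrite insopN IH !oppr0.
by move=> b s; elim: r u => [|i r IH] u; [exact: swap|exact: IH].
Qed.

Lemma alternated_insop u a s : alternated u -> insop u a s = u (a :: s).
Proof.
elim: s u => //= b s IH u au; case: (ltngtP a b) => // ab.
  rewrite (IH (fun t => u (b :: t))); last exact: alternated_cons.
  by rewrite (au.1 [::]) opprK.
by rewrite (val_inj ab) (au.2 [::]).
Qed.

Lemma altop_id u s : alternated u -> altop u s = u s.
Proof.
elim: s u => //= a s IH u au; rewrite -[RHS](IH (fun t => u (a :: t))).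
  by congr (altop _ s); apply/funext => t; exact: alternated_insop.
exact: alternated_cons.
Qed.

Lemma insopB u v a s : insop (fun t => u t - v t) a s = insop u a s - insop v a s.
Proof.
elim: s u v => //= b s IH u v; rewrite IH; case: ifP => // _; case: ifP => // _.
  by rewrite opprD.
by rewrite subr0.
Qed.

Lemma altopB u v s : altop (fun t => u t - v t) s = altop u s - altop v s.
Proof.
elim: s u v => //= a s IH u v; rewrite -IH; congr (altop _ s).
by apply/funext => t; exact: insopB.
Qed.

Section Closed.
Variable Q : G -> Prop.
Hypotheses (Q0 : Q 0) (QB : forall x y, Q x -> Q y -> Q (x - y)).

Lemma insop_closed u a s : (forall t, perm_eq t (a :: s) -> Q (u t)) -> Q (insop u a s).
Proof.
have QN x : Q x -> Q (- x) by rewrite -sub0r; exact: QB.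
elim: s u => [|b s IH] u h /=; first exact: h.
case: ifP => _; first exact: h.
case: ifP => // _; apply: QN; apply: IH => t ts; apply: h.
rewrite perm_sym (_ : [:: a, b & s] = [:: a] ++ [:: b] ++ s)// perm_catCA.
by rewrite perm_cons perm_sym.
Qed.

Lemma altop_closed u s : (forall t, perm_eq t s -> Q (u t)) -> Q (altop u s).
Proof.
elim: s u => [|a s IH] u h /=; first exact: h.
apply: IH => t ts; apply: insop_closed => t' tt'; apply: h.
by rewrite (permPl tt') perm_cons.
Qed.
End Closed.
End Alternation.

Lemma altop_additive N (G H : zmodType) (f : G -> H) (u : seq 'I_N -> G) s :
  f 0 = 0 -> (forall x y, f (x - y) = f x - f y) ->
  altop (fun t => f (u t)) s = f (altop u s).
Proof.
move=> f0 fB; have fN x : f (- x) = - f x by rewrite -sub0r fB f0 sub0r.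
elim: s u => //= a s IH u; rewrite -IH; congr (altop _ s).
apply/funext => t; elim: t u => //= b t IHt u; rewrite IHt.
by case: ifP => // _; case: ifP => // _; rewrite ?fN ?f0.
Qed.

(** * Covers *)

Lemma mem_InP (T : eqType) (x : T) (s : seq T) : List.In x s <-> x \in s.
Proof.
elim: s => //= y s [IH1 IH2]; rewrite inE; split=> [[->|/IH1 ->]|].
- by rewrite eqxx.
- by rewrite orbT.
- by move=> /predU1P[->|/IH2]; [left|right].
Qed.

Lemma compact_finite_cover (X : topologicalType) (K : set X) (P : set X -> Prop) : compact K ->
  (forall x, K x -> exists O, [/\ open O, O x & P O]) ->
  exists s : seq (set X), (forall O, List.In O s -> open O /\ P O) /\
    forall x, K x -> exists2 O, List.In O s & O x.
Proof.
move=> cK hK; pose good s := forall U : set X, List.In U s -> open U /\ P U.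
(* The filter of finite families ordered by inclusion: an eventual property holds for every
   admissible family that contains a certain finite one. *)
pose F : set_system (seq (set X)) := [set Q | exists2 s0, good s0 &
  forall s, good s -> (forall U, List.In U s0 -> List.In U s) -> Q s].
have FF : Filter F.
  split; first by exists [::].
    move=> Q Q' [s gs hs] [s' gs' hs']; exists (s ++ s').
      by move=> U /List.in_app_iff[/gs|/gs'].
    move=> r gr sr; split.
      by apply: hs => // U Us; apply: sr; apply/List.in_app_iff; left.
    by apply: hs' => // U Us; apply: sr; apply/List.in_app_iff; right.
  by move=> Q Q' QQ' [s gs hs]; exists s => // r gr /(hs _ gr)/QQ'.
have /compact_near_coveringP/(_ _ F (fun s x => exists2 U, List.In U s & U x) FF) := cK.
case=> [x Kx|s0 gs0 hs0]; last first.
  by exists s0; split=> //; apply: hs0.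
have [U [oU Ux PU]] := hK _ Kx.
exists (U, [set s | List.In U s]) => /=; last by move=> [y s] [/= Uy Us]; exists U.
split; first exact: open_nbhs_nbhs.
by exists [:: U] => [V [<-|[]]//|s _ hs]; apply: hs; left.
Qed.

Section Covers.
Variables (R : realType) (X : metricType R).
Implicit Types (F A : set X).

Lemma normal_shrink A U : closed A -> open U -> A `<=` U ->
  exists V, [/\ open V, A `<=` V & closure V `<=` U].
Proof.
move=> cA oU AU.
have [B AB BU] : filter_from (set_nbhs A) closure U.
  by have := @pseudometric_normal R X A cA U; apply; apply/set_nbhsP; exists U; split.
have [V [oV AV VB]] := (set_nbhsP _ _).1 AB.
by exists V; split=> //; apply: subset_trans BU; exact: closureS.
Qed.

(** The sets are shrunk one index at a time. The closed set [A] of points of [F] that no other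
    member covers must stay covered, and normality inserts an open set between [A] and [V k]. *)
Lemma shrink_cover F N (V : nat -> set X) : closed F ->
  (forall i, (i < N)%N -> open (V i)) ->
  F `<=` \bigcup_(i in [set i | (i < N)%N]) V i ->
  exists W : nat -> set X, [/\ forall i, (i < N)%N -> open (W i),
    F `<=` \bigcup_(i in [set i | (i < N)%N]) W i &
    forall i, (i < N)%N -> closure (W i) `&` F `<=` V i].
Proof.
move=> cF oV FV.
have H k : (k <= N)%N -> exists W : nat -> set X,
   [/\ forall i, (i < N)%N -> open (W i),
    F `<=` \bigcup_(i in [set i | (i < N)%N]) W i,
    forall i, (i < k)%N -> closure (W i) `&` F `<=` V i &
    forall i, (i < N)%N -> W i `<=` V i]; last first.
  by have [W [oW FW WV _]] := H N (leqnn N); exists W.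
elim: k => [|k IH] kN; first by exists V; split=> // i _ x.
have [W [oW FW WV WS]] := IH (ltnW kN).
pose A := F `&` ~` \bigcup_(i in [set i | (i < N)%N /\ i != k]) W i.
have cA : closed A.
  apply: closedI => //; apply: open_closedC; apply: bigcup_open => i [iN _].
  exact: oW.
have AV : A `<=` V k.
  move=> x [Fx nx]; have [i /= iN Wx] := FW _ Fx.
  have [ik|ik] := eqVneq i k; first by rewrite -ik; exact: WS.
  by case: nx; exists i.
have [B [oB AB BV]] := normal_shrink cA (oV _ kN) AV.
exists (fun i => if i == k then B else W i); split.
- by move=> i iN; case: eqP => // _; exact: oW.
- move=> x Fx; have [Bx|Bx] := EM (B x); first by exists k => //=; rewrite eqxx.
  have : ~ A x by move=> /AB.
  move=> /not_andP[//|/contrapT[i [iN ik] Wx]].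
  by exists i => //=; rewrite (negbTE ik).
- move=> i ik; case: eqP => [->|/eqP nk]; first by move=> x [/BV].
  by apply: WV; rewrite ltn_neqAle nk.
- move=> i iN; case: eqP => [->|_]; last exact: WS.
  by apply: subset_trans BV; exact: subset_closure.
Qed.

Definition piece F N (V : 'I_N -> set X) (i : 'I_N) := closure (V i) `&` F.

Definition pieces F N (V : 'I_N -> set X) (s : seq 'I_N) : set X :=
  [set x | forall i, i \in s -> piece F V i x].

(** Dimension at most [D - 1] allows at most [D] members at each point. Shrinking first makes the
    bound hold for the closed pieces, which lie in the members of the unshrunk cover. *)
Lemma refine_cover F (D : nat) (s : seq (set X)) : closed F ->
  covdim_le F (D%:Z - 1) -> (forall U, List.In U s -> open U) ->
  F `<=` \bigcup_(U in [set U | List.In U s]) U ->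
  exists N (V : 'I_N -> set X), [/\ forall i, open (V i),
    F `<=` \bigcup_i V i,
    forall i, exists2 U, List.In U s & piece F V i `<=` U &
    forall t, uniq t -> (D < size t)%N -> pieces F V t = set0].
Proof.
move=> cF dF oU FU; have [t [ot [Ft [ts tD]]]] := dF s oU FU.
pose V i := nth set0 t i.
have tV i : (i < size t)%N -> List.In (V i) t.
  rewrite /V; elim: t i {ot Ft ts tD V} => // U t IH [|i] /= it; [by left|right].
  exact: IH.
have [|x /Ft[U /= Ut Ux]|W [oW FW WV]] := @shrink_cover F (size t) V cF.
- by move=> i /tV; exact: ot.
- suff [i it VU] : exists2 i, (i < size t)%N & V i = U.
    by exists i => //; rewrite VU.
  rewrite /V; elim: t Ut {ot Ft ts tD V tV} => //= U' t IH [->|/IH[i it <-]].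
    by exists 0%N.
  by exists i.+1.
exists (size t), (fun i : 'I_(size t) => W i); split.
- by move=> i; exact: oW.
- by move=> x /FW[i /= it Wx]; exists (Ordinal it).
- move=> i; have [U Us VU] := ts _ (tV _ (ltn_ord i)); exists U => //.
  by move=> x [Wx Fx]; apply: VU; split=> //; exact: (WV i).
- move=> r ur Dr; rewrite -subset0 => x hx.
  have Fx : F x by case: r {ur} Dr hx => // i r _ /(_ i (mem_head _ _))[].
  have := tD _ Fx; rewrite subrK lez_nat leqNgt => /negP; apply.
  (* [count] runs over positions, so a set listed twice counts twice, and distinct indices of pieces
     give distinct positions. *)
  apply: leq_trans Dr _; rewrite -[t in count _ t](mkseq_nth set0) -/V.
  rewrite -(size_map val) count_map -size_filter.
  apply: uniq_leq_size; first by rewrite map_inj_uniq//; exact: val_inj.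
  move=> _ /mapP[i ir ->]; rewrite mem_filter mem_iota /= ltn_ord andbT.
  by apply/asboolP; apply: (WV i) => //; exact: hx.
Qed.
End Covers.

(** * Killing relative cycles *)

Section Supports.
Variables (R : realType) (X : metricType R) (U : set X).
Local Notation simplex := (simplex R X).

Lemma sing_image_compact A k (s : simplex k) : singular_in A s ->
  compact (s @` @std_simplex R k).
Proof. by move=> [cs _]; apply: continuous_compact => //; exact: std_compact. Qed.

Lemma supp_compact k (c : fab (simplex k)) : supp (sing U (k:=k)) c ->
  exists K, [/\ compact K, K `<=` U & supp (sing K (k:=k)) c].
Proof.
move=> hc; elim/fab_ind : hc => [|a b [K [cK KU aK]] [L [cL LU bL]]|s [ns hs]].
- by exists set0; split=> //; [exact: compact0|exact: supp0].
- exists (K `|` L); split; [exact: compactU|by move=> x [/KU|/LU]|].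
  apply: suppB; first by apply: sub_supp aK => s; apply: sub_sing => x; left.
  by apply: sub_supp bL => s; apply: sub_sing => x; right.
- exists (s @` @std_simplex R k); split; [exact: sing_image_compact hs|exact: hs.2|].
  by apply: supp_gen; split=> //; split; [exact: hs.1|].
Qed.

(** Finitely many compact, hence closed, images that miss a point also miss a neighbourhood of it.
    This spreads vanishing at a point to nearby points. *)
Lemma supp_avoid_point k (c : fab (simplex k)) x :
  supp (sing (~` [set x]) (k:=k)) c ->
  exists O, [/\ open O, O x & supp (sing (~` O) (k:=k)) c].
Proof.
move=> hc; elim/fab_ind : hc => [|a b [W [oW Wx aW]] [V [oV Vx bV]]|s [ns [cs hs]]].
- by exists setT; split=> //; [exact: openT|exact: supp0].
- exists (W `&` V); split=> //; first exact: openI.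
  apply: suppB; first by apply: sub_supp aW => s; apply: sub_sing => y Wy [].
  by apply: sub_supp bV => s; apply: sub_sing => y Uy [].
- exists (~` (s @` @std_simplex R k)); split.
  + apply: closed_openC; apply: compact_closed; first exact: metric_hausdorff.
    by apply: (@sing_image_compact (~` [set x])).
  + by move=> /hs /(_ erefl).
  + by apply: supp_gen; split=> //; split=> //; rewrite setCK.
Qed.

(** For a chain [z] in [U] whose boundary misses [A], this is the vanishing of its class in the
    relative homology of [(U, U \ A)]. *)
Definition kill (A : set X) k (z : fab (simplex k)) :=
  exists2 y, supp (sing U (k:=k.+1)) y & supp (sing (~` A) (k:=k)) (z - bd y).

Lemma sub_kill A B k (z : fab (simplex k)) : B `<=` A -> kill A z -> kill B z.
Proof.
move=> BA [y hy zy]; exists y => //; apply: sub_supp zy => s.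
by apply: sub_sing => x; apply: contra_not; exact: BA.
Qed.

Lemma kill_avoid A k (z : fab (simplex k)) : supp (sing (~` A) (k:=k)) z -> kill A z.
Proof. by move=> hz; exists 0; [exact: supp0|rewrite bd0 subr0]. Qed.
(** Subdivision preserves the relative class: [c'] and [SD c'] differ by [bd (TT c')] and by
    [TT (bd c')], and the latter misses [A]. *)
Lemma kill_iter_SD A m k (c : fab (simplex k.+1)) :
  supp (sing U (k:=k.+1)) c -> supp (sing (~` A) (k:=k)) (bd c) ->
  kill A (iter m (@SD R X k.+1) c) -> kill A c.
Proof.
move=> cT cb; elim: m => // m IH; rewrite iterS => -[y yT hy]; apply: IH.
set c' := iter m _ c in hy *.
have c'T : supp (sing U (k:=k.+1)) c' by exact: sing_iter_SD.
exists (y + TT c'); first by apply: suppD => //; exact: sing_TT.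
have -> : c' - bd (y + TT c') = (SD c' - bd y) + TT (bd c').
  have aux (a b y' p q : fab (simplex k.+1)) : p + q = a - b -> a - (y' + p) = b - y' + q.
    move=> h; have -> : a = b + (p + q) by rewrite h addrC subrK.
    by rewrite opprD addrACA [p + q]addrC addrK.
  by rewrite bdD; apply: aux; exact: (bd_TT c'T).
apply: suppD => //; apply: sing_TT.
by rewrite (bd_iter_SD _ cT); exact: sing_iter_SD.
Qed.

(** The bounding chain [y] may leave [U]. As [U] and the complement of [A] cover [X], enough
    subdivision puts each simplex of [y] in one of them; those in [U] are kept, and the others have
    boundaries that miss [A]. *)
Lemma excision A B k (c : fab (simplex k.+1)) : open U -> closed A -> A `<=` U ->
  supp (sing U (k:=k.+1)) c -> supp (sing (~` A) (k:=k)) (bd c) ->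
  (exists2 y, supp (sing B (k:=k.+2)) y & supp (sing (~` A) (k:=k.+1)) (c - bd y)) ->
  kill A c.
Proof.
move=> oU cA AU cU cb [y yT hy].
pose O (b : bool) := if b then U else ~` A.
have [|m /(_ m (leqnn m)) hm] := @small_chain _ _ _ _ O y.
  apply: sub_supp yT => s ys; split; first exact: sub_sing ys.
  move=> t st; have [Us|nUs] := EM (U (s t)).
    by exists true; exact: open_nbhs_nbhs.
  by exists false; apply: open_nbhs_nbhs; split; [exact: closed_openC|move=> /AU].
have [|d1 [d2 [h1 h2 yE]]] := @supp_split _ (sing U (k:=k.+2)) (sing (~` A) (k:=k.+2))
    (iter m (@SD R X k.+2) y).
  by apply: sub_supp hm => s [[] ?]; [left|right].
apply: (@kill_iter_SD A m _ c cU cb); exists d1 => //.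
have -> : iter m (@SD R X k.+1) c - bd d1 = iter m (@SD R X k.+1) (c - bd y) + bd d2.
  rewrite iter_SDB -(bd_iter_SD _ yT) yE bdD opprD addrA subrK //.
by apply: suppD; [exact: sing_iter_SD|exact: sing_bd].
Qed.
End Supports.

Lemma bounded_tuples (N k : nat) (P : seq 'I_N -> nat -> Prop) :
  (forall s, exists m0, forall m, (m0 <= m)%N -> P s m) ->
  exists m, forall s, size s = k -> P s m.
Proof.
move=> /choice[f hf]; exists (\max_(t : k.-tuple 'I_N) f t) => s sk.
by apply: hf; exact: (leq_bigmax (Tuple (introT eqP sk))).
Qed.

Section SelectPiece.
Variables (R : realType) (X : metricType R) (N k : nat) (E : 'I_N -> set X).
Local Notation simplex := (simplex R X k).

(* For simplices missing all the sets [E i] any index will do. *)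
Definition selector (s : simplex) : option 'I_N :=
  if [pick i | `[< ~ sing (~` E i) s >]] is Some i then Some i else [pick i].

Definition select (i : 'I_N) : fab simplex -> fab simplex :=
  lin (fun s => if selector s == Some i then gen s else 0).

Lemma selectB i c d : select i (c - d) = select i c - select i d.
Proof. exact: linB. Qed.

Lemma select0 i : select i 0 = 0.
Proof. exact: lin0. Qed.

Lemma supp_select i P c :
  supp P c -> supp (fun s => P s /\ selector s = Some i) (select i c).
Proof.
apply: supp_lin => s Ps; case: eqP => e; last exact: supp0.
exact: supp_gen.
Qed.

Lemma sum_select (i0 : 'I_N) c : \sum_i select i c = c.
Proof.
elim/(@fab_ind simplex (fun=> True)) : (@suppT _ c) => [|a b ea eb|s _].
- by rewrite big1// => i _; exact: select0.
- rewrite -[in RHS]ea -[in RHS]eb -sumrB.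
  by apply: eq_bigr => i _; exact: selectB.
- have [j sj] : exists j, selector s = Some j.
    rewrite /selector; case: pickP => [j _|_]; first by exists j.
    by case: pickP => [j _|/(_ i0)//]; exists j.
  rewrite (bigD1 j)//= big1 ?addr0 /select.
    by rewrite lin_gen sj eqxx.
  by move=> i ij; rewrite lin_gen sj; case: eqP => // -[ji]; rewrite ji eqxx in ij.
Qed.

(** A simplex assigned to [i] either meets [E i] or misses every [E]. So if it misses one of the
    sets indexed by [i :: r], it misses one indexed by [r] as soon as [r] is nonempty. *)
Lemma selectorP i s (r : seq 'I_N) : selector s = Some i -> r <> [::] ->
  (exists2 l, l \in i :: r & sing (~` E l) s) -> exists2 l, l \in r & sing (~` E l) s.
Proof.
move=> si r0 [l]; rewrite inE => /predU1P[->|lr sl]; last by exists l.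
move: si; rewrite /selector; case: pickP => [j /asboolP nj [<-]//|h _ _].
case: r r0 => // j r _; exists j; first exact: mem_head.
by have /asboolP/contrapT := negbT (h j).
Qed.
End SelectPiece.

(** * Cech cochains with values in relative cycles *)

Section Cech.
Variables (R : realType) (X : metricType R) (U F : set X) (D : nat).
Local Notation kill := (kill U).
Hypotheses (cF : closed F) (dF : covdim_le F (D%:Z - 1)).
Local Notation simplex := (simplex R X).

Lemma closed_piece N (V : 'I_N -> set X) i : closed (piece F V i).
Proof. by apply: closedI => //; exact: closed_closure. Qed.

Lemma closed_pieces N (V : 'I_N -> set X) s : closed (pieces F V s).
Proof.
have -> : pieces F V s = \bigcap_(i in [set i | i \in s]) piece F V i by [].
by apply: closed_bigI => i _; exact: closed_piece.
Qed.

Lemma sub_pieces N (V : 'I_N -> set X) s t : {subset t <= s} ->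
  pieces F V s `<=` pieces F V t.
Proof. by move=> ts x hx i /ts; exact: hx. Qed.

Lemma pieces_map N N' (V : 'I_N -> set X) (V' : 'I_N' -> set X) r s :
  (forall i, piece F V' i `<=` piece F V (r i)) ->
  pieces F V' s `<=` pieces F V (map r s).
Proof. by move=> h x hx _ /mapP[i si ->]; apply: h; exact: hx. Qed.

Lemma supp_sub_sing (A B : set X) k (c : fab (simplex k)) : B `<=` A ->
  supp (sing (~` A) (k:=k)) c -> supp (sing (~` B) (k:=k)) c.
Proof. by move=> BA; apply: sub_supp => s; apply: sub_sing => x; apply: contra_not; exact: BA. Qed.

(* A cochain of chains on the cover of F by the closures of the V i: its value
   at s is a relative cycle of (X, X \ pieces s), and it is a Cech cocycle of
   degree p modulo chains missing the pieces. *)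
Definition cocycle N (V : 'I_N -> set X) p j (z : seq 'I_N -> fab (simplex j.+1)) :=
  [/\ alternated z, forall s, supp (sing U (k:=j.+1)) (z s),
     forall s, size s = p.+1 -> supp (sing (~` pieces F V s) (k:=j)) (bd (z s)) &
     forall s, size s = p.+2 -> supp (sing (~` pieces F V s) (k:=j.+1)) (dl z s)].

Definition open_cover N (V : 'I_N -> set X) :=
  (forall i, open (V i)) /\ F `<=` \bigcup_i V i.

(** Vanishing of the local homology of [U] at its points, in degree [j.+1]. *)
Definition stalk_trivial j := forall x (c : fab (simplex j.+1)), U x ->
  supp (sing U (k:=j.+1)) c ->
  supp (sing (~` [set x]) (k:=j)) (bd c) -> kill [set x] c.

Lemma local_kill N (V : 'I_N -> set X) p j (z : seq 'I_N -> fab (simplex j.+1)) :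
  stalk_trivial j -> cocycle V p z -> forall x, U x -> exists O, [/\ open O, O x &
    forall s, size s = p.+1 -> kill (O `&` pieces F V s) (z s)].
Proof.
move=> hst [_ zT zb _] x Ux.
suff h (l : seq (p.+1.-tuple 'I_N)) : exists O, [/\ open O, O x &
    forall s, s \in l -> kill (O `&` pieces F V s) (z s)].
  have [B [oB Bx hB]] := h (enum {: p.+1.-tuple 'I_N}).
  exists B; split=> // s sp; rewrite -[s]/(val (Tuple (introT eqP sp))).
  by apply: hB; rewrite mem_enum.
elim: l => [|s l [B [oB Bx hB]]]; first by exists setT; split=> //; exact: openT.
have [B' [oB' B'x hB']] : exists O, [/\ open O, O x & kill (O `&` pieces F V s) (z s)].
  have [px|px] := EM (pieces F V s x).
    have [|y hy] := hst x (z s) Ux (zT s).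
      by apply: supp_sub_sing (zb s _); [move=> _ ->|exact: size_tuple].
    move=> /supp_avoid_point[W [oW Wx hW]]; exists W; split=> //.
    by exists y => //; apply: supp_sub_sing hW => y' [].
  (* Away from the closed set [pieces F V s] there is nothing to kill. *)
  exists (~` pieces F V s); split=> //; first by apply: closed_openC; exact: closed_pieces.
  exists 0; first exact: supp0.
  rewrite bd0 subr0; apply: sub_supp (zT s) => t [nt [ct _]].
  by split=> //; split=> // y _ [].
exists (B `&` B'); split=> //; first exact: openI.
move=> t; rewrite inE => /predU1P[->|/hB].
  by apply: sub_kill hB' => y [[]].
by apply: sub_kill => y [[]].
Qed.

(** Covering dimension handles finite covers only, and [F] need not be compact. Good neighbourhoods
    are therefore needed only over a compact [K] that carries the finitely many chains in question;
    the complement of [K] is good because these chains miss it. *)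
Lemma refine_kill N (V : 'I_N -> set X) p j (z : seq 'I_N -> fab (simplex j.+1)) :
  stalk_trivial j -> open_cover V -> cocycle V p z ->
  exists N' (V' : 'I_N' -> set X) (r : 'I_N' -> 'I_N), [/\ open_cover V',
    forall i, piece F V' i `<=` piece F V (r i) &
    forall s, size s = p.+1 -> kill (pieces F V' s) (z (map r s))].
Proof.
move=> hst [oV FV] hz; have [_ zT _ _] := hz.
pose good (O : set X) := forall s, size s = p.+1 -> kill (O `&` pieces F V s) (z s).
have [K [cK KU hK]] : exists K, [/\ compact K, K `<=` U &
    forall s, size s = p.+1 -> supp (sing K (k:=j.+1)) (z s)].
  suff [K [cK KU hK]] : exists K, [/\ compact K, K `<=` U & forall s : p.+1.-tuple 'I_N,
      s \in enum {: p.+1.-tuple 'I_N} -> supp (sing K (k:=j.+1)) (z s)].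
    exists K; split=> // s sp; rewrite -[s]/(val (Tuple (introT eqP sp))).
    by apply: hK; rewrite mem_enum.
  elim: (enum _) => [|s l [K [cK KU hK]]].
    by exists set0; split=> //; exact: compact0.
  have [L [cL LU hL]] := supp_compact (zT s).
  exists (K `|` L); split; [exact: compactU|by move=> x [/KU|/LU]|].
  move=> t; rewrite inE => /predU1P[->|/hK].
    by apply: sub_supp hL => u; apply: sub_sing => y; right.
  by apply: sub_supp => u; apply: sub_sing => y; left.
have [|S [hS KS]] := @compact_finite_cover _ K good cK.
  by move=> x /KU Ux; exact: (local_kill hst hz).
have gK : good (~` K).
  move=> s sp; apply: kill_avoid; apply: sub_supp (hK s sp) => t.
  by apply: sub_sing => y Ky [].
have oK : open (~` K).
  by apply: closed_openC; apply: compact_closed => //; exact: metric_hausdorff.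
pose T := [seq V i `&` W | i <- enum 'I_N, W <- ~` K :: S].
have hT B : List.In B T -> exists i O, [/\ open O, good O & B = V i `&` O].
  rewrite /T; elim: (enum 'I_N) => //= i l IH [UE|UT].
    by exists i, (~` K).
  have [/List.in_map_iff[W [WE /hS[oW gW]]]|/IH//] := (List.in_app_iff _ _ _).1 UT.
  by exists i, W.
have Th i O : List.In O (~` K :: S) -> List.In (V i `&` O) T.
  move=> OS; rewrite /T; have := mem_enum 'I_N i.
  rewrite inE; elim: (enum 'I_N) => //= k l IH.
  rewrite inE => /predU1P[->|/IH h]; last by right; apply/List.in_app_iff; right.
  case: OS => [<-|OS]; [by left|right; apply/List.in_app_iff; left].
  by apply/List.in_map_iff; exists O.
have [||N' [V' [oV' FV' V'T _]]] := @refine_cover _ _ F D T cF dF.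
- by move=> B /hT[i [W [oW _ ->]]]; exact: openI.
- move=> x Fx; have [i _ Vx] := FV _ Fx.
  have [Kx|nKx] := EM (K x).
    by have [W WS Wx] := KS _ Kx; exists (V i `&` W) => //; apply: Th; right.
  by exists (V i `&` ~` K) => //; apply: Th; left.
have /choice[r hr] i : exists k, exists O, good O /\ piece F V' i `<=` piece F V k `&` O.
  have [B /hT[k [W [_ gW ->]]] hB] := V'T i; exists k, W; split=> // x hx.
  have [Vx Wx] := hB _ hx; split=> //; split; first exact: subset_closure.
  exact: hx.2.
exists N', V', r; split=> // [i|s sp]; first by have [W [_ h]] := hr i; move=> x /h[].
(* A list of length [p.+1] has an index, and the good set attached to one index contains the whole
   intersection of pieces. *)
have [i si] : exists i, i \in s by case: s sp => // i s _; exists i; exact: mem_head.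
have [W [gW hW]] := hr i.
have := gW (map r s); rewrite size_map => /(_ sp); apply: sub_kill => x hx; split.
  by have /hW[] := hx i si.
by apply: pieces_map hx => k; have [W' [_ h]] := hr k; move=> y /h[].
Qed.

Lemma piece_index N N' (V : 'I_N -> set X) (V' : 'I_N' -> set X) :
  (forall i, exists2 B, List.In B (codom V) & piece F V' i `<=` B) ->
  exists r : 'I_N' -> 'I_N, forall i, piece F V' i `<=` piece F V (r i).
Proof.
move=> h; have /choice[r hr] i : exists k, piece F V' i `<=` V k.
  have [B + hB] := h i; rewrite /codom /image_mem => /List.in_map_iff[k [kB _]].
  by exists k; rewrite kB.
by exists r => i x hx; split; [apply: subset_closure; exact: hr|exact: hx.2].
Qed.

(** Bounding chains are chosen independently for each list and then sorted into an alternating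
    family. This respects the estimates because [pieces] depends only on the set of indices. *)
Lemma antisymmetric_extension N (V : 'I_N -> set X) k l (z : seq 'I_N -> fab (simplex k)) :
  alternated z -> (forall s, size s = l -> kill (pieces F V s) (z s)) ->
  exists y : seq 'I_N -> fab (simplex k.+1), [/\ alternated y,
    forall s, supp (sing U (k:=k.+1)) (y s) &
    forall s, size s = l -> supp (sing (~` pieces F V s) (k:=k)) (z s - bd (y s))].
Proof.
move=> az hz; have /choice[y hy] s : exists y, supp (sing U (k:=k.+1)) y /\
    (size s = l -> supp (sing (~` pieces F V s) (k:=k)) (z s - bd y)).
  have [/hz[y yT hy]|ns] := EM (size s = l); first by exists y.
  by exists 0; split=> //; exact: supp0.
exists (altop y); split; first exact: alternated_altop.
  move=> s; apply: altop_closed => [|a b|t _]; [exact: supp0|exact: suppB|].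
  exact: (hy t).1.
move=> s sl; rewrite -[z s](altop_id s az) -(@altop_additive _ _ _ (@bd R X k)) ?bd0//; last first.
  exact: bdB.
rewrite -altopB; apply: altop_closed => [|a b|t ts]; [exact: supp0|exact: suppB|].
have : supp (sing (~` pieces F V t) (k:=k)) (z t - bd (y t)).
  by apply: (hy t).2; rewrite (perm_size ts).
by apply: supp_sub_sing; apply: sub_pieces => i; rewrite (perm_mem ts).
Qed.

(* Exactness of the Cech complex of the (fine) groups of small chains. *)
Lemma cech_small N (V : 'I_N -> set X) p k (u : seq 'I_N -> fab (simplex k)) :
  alternated u -> (forall s, supp (sing U (k:=k)) (u s)) ->
  (forall s, size s = p.+2 -> supp (sing (~` pieces F V s) (k:=k)) (dl u s)) ->
  exists m v, [/\ alternated v, forall s, supp (sing U (k:=k)) (v s) &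
    forall s, size s = p.+1 ->
      supp (sing (~` pieces F V s) (k:=k)) (iter m (@SD R X k) (u s) - dl v s)].
Proof.
move=> au uT hu.
pose small (s : seq 'I_N) (t : simplex k) := exists2 i, i \in s & sing (~` piece F V i) t.
have [m hm] : exists m, forall s, size s = p.+2 ->
    supp (small s) (iter m (@SD R X k) (dl u s)).
  have [|m hm] := @bounded_tuples N p.+2 (fun s m => size s = p.+2 ->
      supp (small s) (iter m (@SD R X k) (dl u s))); last first.
    by exists m => s ss; exact: hm.
  move=> s; have [/hu hs|ns] := EM (size s = p.+2); last by exists 0%N.
  have [|m0 h] := small_chain (O := fun i : {i | i \in s} => ~` piece F V (sval i)) (c := dl u s).
    apply: sub_supp hs => t [nt [ct ht]]; split; first by split.
    move=> t0 st0; have /existsNP[i /not_implyP[si ni]] : ~ pieces F V s (t t0).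
      by apply: ht; exists t0.
    exists (exist _ i si); apply: open_nbhs_nbhs; split=> //.
    by apply: closed_openC; exact: closed_piece.
  by exists m0 => m /h hm _; apply: sub_supp hm => t [[i si] ti]; exists i.
pose w s := iter m (@SD R X k) (u s).
have aw : alternated w.
  by apply: alternated_additive au; [exact: iter_SD0|exact: iter_SDB].
(* [select] acts as a partition of unity, and this is the resulting contracting homotopy. *)
pose v s := \sum_i select (piece F V) i (w (i :: s)).
exists m, v; split.
- split=> r a => [b s|s].
    rewrite -sumrN; apply: eq_bigr => i _; rewrite (aw.1 (i :: r) a b s).
    by rewrite -sub0r selectB select0 sub0r.
  by rewrite /v big1// => i _; rewrite (aw.2 (i :: r) a s) select0.
- move=> s; apply: supp_sum => i _.
  have : supp (sing U (k:=k)) (w (i :: s)) by apply: sing_iter_SD; exact: uT.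
  move=> /(@supp_select _ _ _ _ (piece F V) i).
  by apply: sub_supp => t [].
- move=> s sp; have [i0 [s' sE]] : exists i0 s', s = i0 :: s'.
    by case: s sp => // i0 s' _; exists i0, s'.
  have dlw i : dl (fun t => w (i :: t)) s = w s - dl w (i :: s) by rewrite /= subKr.
  (* The error consists of simplices of [dl w (i :: s)] assigned to [i]. By smallness each misses a
     piece indexed by [i :: s], hence by [selectorP] one indexed by [s]. *)
  have -> : dl v s = w s - \sum_i select (piece F V) i (dl w (i :: s)).
    rewrite /v dl_sum -[w s in RHS](sum_select (piece F V) i0) -sumrB.
    apply: eq_bigr => i _; rewrite -selectB -dlw.
    by apply: dl_additive; [exact: select0|exact: selectB].
  rewrite subKr; apply: supp_sum => i _.
  have := hm (i :: s); rewrite -(@dl_additive _ _ _ (iter m (@SD R X k)))//=; last 2 first.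
  + exact: iter_SD0.
  + exact: iter_SDB.
  rewrite sp => /(_ erefl)/(@supp_select _ _ _ _ (piece F V) i).
  apply: sub_supp => t [ht st].
  have [|l ls lt] := selectorP st _ ht; first by rewrite sE.
  by apply: sub_sing lt => x; apply: contra_not => /(_ l ls).
Qed.

Lemma cocycle_map N N' (V : 'I_N -> set X) (V' : 'I_N' -> set X) r p j
    (z : seq 'I_N -> fab (simplex j.+1)) :
  (forall i, piece F V' i `<=` piece F V (r i)) ->
  cocycle V p z -> cocycle V' p (fun s => z (map r s)).
Proof.
move=> hr [az zT zb zd]; split.
- exact: alternated_map.
- by move=> s; exact: zT.
- move=> s sp; apply: supp_sub_sing (zb _ _); last by rewrite size_map.
  exact: pieces_map.
- move=> s sp; rewrite dl_map; apply: supp_sub_sing (zd _ _); last by rewrite size_map.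
  exact: pieces_map.
Qed.

(* Dimension shifting: a degree p cocycle z bounds y locally, the coboundary of
   y is a degree p + 1 cocycle of chains of one dimension more, and beyond the
   order of the covers every cocycle vanishes. *)
Lemma cech q p j N (V : 'I_N -> set X) (z : seq 'I_N -> fab (simplex j.+1)) :
  (p + q = D)%N -> (forall i, (i < q)%N -> stalk_trivial (j + i)) ->
  open_cover V -> cocycle V p z ->
  exists N' (V' : 'I_N' -> set X) (r : 'I_N' -> 'I_N) m
    (v : seq 'I_N' -> fab (simplex j.+2)),
   [/\ open_cover V', forall i, piece F V' i `<=` piece F V (r i),
     alternated v, forall s, supp (sing U (k:=j.+2)) (v s) &
     forall s, size s = p.+1 -> supp (sing (~` pieces F V' s) (k:=j.+1))
       (iter m (@SD R X j.+1) (z (map r s)) - bd (dl v s))].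
Proof.
elim: q p j N V z => [|q IH] p j N V z pq hst cV hz.
  have [||N' [V' [oV' FV' V'V V'D]]] := @refine_cover _ _ F D (codom V) cF dF.
  - move=> B; rewrite /codom /image_mem => /List.in_map_iff[i [<- _]].
    exact: cV.1.
  - move=> x /cV.2[i _ Vx]; exists (V i) => //.
    by rewrite /codom /image_mem; apply/List.in_map_iff; exists i; split=> //;
      apply/mem_InP; rewrite mem_enum.
  have [r hr] := piece_index V'V.
  have [az zT _ _] := cocycle_map hr hz.
  exists N', V', r, 0%N, (fun=> 0); split=> //.
  - by split=> *; rewrite ?oppr0.
  - by move=> s; exact: supp0.
  (* Here [p = D]: on [D + 1] distinct indices the pieces have empty intersection, and on repeated
     indices the cochain vanishes. *)
  move=> s sp; rewrite (_ : dl _ s = 0); last first.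
    by apply: (@dl_closed _ _ (eq^~ 0)) => // x y -> ->; rewrite subr0.
  rewrite bd0 subr0 /=; have [us|nus] := boolP (uniq s).
    rewrite V'D ?sp -?pq ?addn0// setC0.
    by apply: sub_supp (zT s) => t; exact: sub_sing.
  by rewrite (alternated_uniq az nus); exact: supp0.
have hst0 : stalk_trivial j by have := hst 0%N isT; rewrite addn0.
have [N1 [V1 [r1 [cV1 V1V hk]]]] := refine_kill hst0 cV hz.
have hz1 := cocycle_map V1V hz; have [az1 z1T z1b z1d] := hz1.
have [y [ay yT hy]] := antisymmetric_extension az1 hk.
have hdy : cocycle V1 p.+1 (dl y).
  split.
  - exact: alternated_dl.
  - move=> s; apply: dl_closed => [a b||t _ _]; [exact: suppB|exact: supp0|exact: yT].
  - move=> s sp.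
    (* [bd] and [dl] commute, so the boundary of [dl y] differs from the coboundary of [z] by chains
       missing the pieces, and that coboundary misses them too. *)
    have -> : bd (dl y s) = dl (fun t => z (map r1 t)) s -
        dl (fun t => z (map r1 t) - bd (y t)) s.
      rewrite dlB subKr; apply/esym/dl_additive; [exact: bd0|exact: bdB].
    apply: suppB; first exact: z1d.
    apply: dl_closed => [a b||t ts tsub]; [exact: suppB|exact: supp0|].
    move: ts; rewrite sp => -[] /hy; apply: supp_sub_sing.
    exact: sub_pieces.
  - by move=> s _; rewrite dlK; exact: supp0.
have pq1 : (p.+1 + q = D)%N by rewrite addSnnS.
have hst1 i : (i < q)%N -> stalk_trivial (j.+1 + i).
  by move=> iq; rewrite addSnnS; exact: hst.
have [N2 [V2 [r2 [m [v2 [cV2 V2V1 av2 v2T hv2]]]]]] := IH _ _ _ _ _ pq1 hst1 cV1 hdy.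
(* Correcting [y] by [bd v2] makes it a cocycle modulo chains missing the pieces, without changing
   its boundary. Such a cocycle is, after subdivision, a coboundary [dl v] modulo chains of the same
   kind. *)
pose u s := iter m (@SD R X j.+2) (y (map r2 s)) - bd (v2 s).
have au : alternated u.
  apply: alternatedB; last by apply: alternated_additive => //; [exact: bd0|exact: bdB].
  apply: (@alternated_additive _ _ _ (iter m (@SD R X j.+2)) (fun s => y (map r2 s))).
  - exact: iter_SD0.
  - exact: iter_SDB.
  - exact: alternated_map.
have uT s : supp (sing U (k:=j.+2)) (u s).
  by apply: suppB; [apply: sing_iter_SD; exact: yT|apply: sing_bd; exact: v2T].
have hu s : size s = p.+2 -> supp (sing (~` pieces F V2 s) (k:=j.+2)) (dl u s).
  move=> /hv2; rewrite /u dlB.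
  rewrite (@dl_additive _ _ _ (@bd R X j.+2))//; [|exact: bd0|exact: bdB].
  rewrite (@dl_additive _ _ _ (iter m (@SD R X j.+2)) (fun s => y (map r2 s)));
    [|exact: iter_SD0|exact: iter_SDB].
  by rewrite dl_map.
have [m' [v [av vT hv]]] := cech_small au uT hu.
exists N2, V2, (r1 \o r2), (m' + m)%N, v; split=> //.
  by move=> i x /V2V1/V1V.
move=> s sp; rewrite map_comp; set s1 := map r2 s.
have E : bd (iter m' (@SD R X j.+2) (u s)) =
    iter (m' + m) (@SD R X j.+1) (bd (y s1)).
  rewrite (bd_iter_SD _ (uT s)) /u bdB bdK subr0 (bd_iter_SD _ (yT s1)).
  by rewrite -iterD.
have -> : iter (m' + m) (@SD R X j.+1) (z (map r1 s1)) - bd (dl v s) =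
    iter (m' + m) (@SD R X j.+1) (z (map r1 s1) - bd (y s1)) +
    bd (iter m' (@SD R X j.+2) (u s) - dl v s).
  by rewrite iter_SDB bdB E addrA subrK.
apply: suppD; last by apply: sing_bd; exact: hv.
apply: sing_iter_SD; apply: supp_sub_sing (hy s1 _); last by rewrite size_map.
exact: pieces_map.
Qed.

(* The case p = 0 applied to the constant cocycle. *)
Lemma kill_closed j (c : fab (simplex j.+1)) :
  (forall i, (i < D)%N -> stalk_trivial (j + i)) ->
  supp (sing U (k:=j.+1)) c -> supp (sing (~` F) (k:=j)) (bd c) -> kill F c.
Proof.
move=> hst cT cb.
pose z (s : seq 'I_1) := if size s == 1%N then c else 0.
have cV : open_cover (fun _ : 'I_1 => @setT X).
  by split=> [i|x _]; [exact: openT|exists ord0].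
have hz : cocycle (fun _ : 'I_1 => @setT X) 0 z.
  split.
  - by split=> r *; rewrite /z !size_cat /= !addnS /= ?oppr0.
  - by move=> s; rewrite /z; case: ifP => _ //; exact: supp0.
  - move=> s s1; rewrite /z s1; apply: supp_sub_sing cb => x /(_ (head ord0 s)).
    by case: s s1 => // i s _ /(_ (mem_head _ _))[].
  - by case=> // i [|k []]// _; rewrite /= subr0 subrr; exact: supp0.
have [N [V [r [m [v [[oV FV] _ av vT hv]]]]]] := cech (add0n D) hst cV hz.
have [[x Fx]|F0] := EM (exists x, F x); last first.
  exists 0; first exact: supp0.
  rewrite bd0 subr0; apply: sub_supp cT => s; apply: sub_sing => x _ Fx.
  by apply: F0; exists x.
(* On a one-element list the coboundary of [v] is [v [::]], independently of the index. So the same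
   bounding chain works on every piece, and the pieces cover [F]. *)
apply: (kill_iter_SD (m := m) cT cb); exists (v [::]); first exact: vT.
have [i0 _ _] := FV _ Fx.
move=> s cs; have hs i : sing (~` piece F V i) s.
  have := hv [:: i] erefl; rewrite /z /= subr0 => /(_ s cs).
  by apply: sub_sing => y hy Vy; apply: hy => k; rewrite inE => /eqP->.
have [ns [cts _]] := hs i0; split=> //; split=> // _ [t st <-] Ft.
have [i _ Vi] := FV _ Ft; have [_ [_ /(_ (s t))]] := hs i; apply.
  by exists t.
by split=> //; exact: subset_closure.
Qed.
End Cech.

(** * Closed sets of small dimension do not separate *)

Section NonSeparation.
Variables (R : realType) (X : metricType R).
Local Notation simplex := (simplex R X).

Definition path_in (A : set X) (a b : X) := exists f : R -> X,
  [/\ {within `[0, 1]%classic, continuous f}, f 0 = a, f 1 = b &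
      f @` `[0, 1]%classic `<=` A].

Lemma sgen_cst (s : simplex 0) x : (forall t, std_simplex t -> s t = x) ->
  sgen s = sgen (cst x).
Proof. by move=> h; congr gen; exact: eq_nrm. Qed.

Lemma std0E (t : 'rV[R]_1) : std_simplex t -> t ord0 ord0 = 1.
Proof. by move=> [_]; rewrite big_ord1. Qed.

Lemma bds1 (s : simplex 1) : bds s =
  sgen (cst (s (delta_mx ord0 ord_max))) - sgen (cst (s (delta_mx ord0 ord0))).
Proof.
rewrite /bds big_ord_recl big_ord1 /= expr0 expr1 mulr1z mulrN1z.
congr (_ - _); apply: sgen_cst => t /std0E t1 /=; congr s; apply/rowP => j;
  rewrite !mxE eqxx /=; case: unliftP => [k ->|->].
- by rewrite (ord1 k) t1.
- by [].
- by rewrite (ord1 k) t1.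
- by [].
Qed.

Lemma sing_cst (A : set X) k x : A x -> sing A (nrm (cst x : simplex k)).
Proof.
move=> Ax; apply: sing_nrm; split; last by move=> _ [t _ <-].
by apply/cont_onP => t _ W /nbhs_singleton Wx; apply: filterE.
Qed.

Definition edge (r : R) : 'rV[R]_2 :=
  (1 - r) *: delta_mx ord0 ord0 + r *: delta_mx ord0 ord_max.

Lemma edge_continuous : continuous edge.
Proof.
move=> r; apply: cvgD; last by apply: cvgZr_tmp; exact: cvg_id.
by apply: cvgZr_tmp; apply: cvgB; [exact: cvg_cst|exact: cvg_id].
Qed.

Lemma std_edge r : `[0, 1]%classic r -> std_simplex (edge r).
Proof.
rewrite /= in_itv /= => /andP[r0 r1]; split=> [i|].
  by rewrite !mxE addr_ge0// mulr_ge0// subr_ge0.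
by rewrite big_ord_recl big_ord1 !mxE /= !mulr1 !mulr0 addr0 add0r subrK.
Qed.

Lemma clopen_simplex (A B : set X) (s : simplex 1) : singular_in A s ->
  (exists2 C, open C & B = A `&` C) -> (exists2 C, closed C & B = A `&` C) ->
  B (s (delta_mx ord0 ord0)) <-> B (s (delta_mx ord0 ord_max)).
Proof.
move=> [cs sA] [C oC BC] [C' cC' BC'].
pose E := (s \o edge) @` `[0, 1]%classic.
have cE : connected E.
  apply: connected_continuous_connected; first exact: segment_connected.
  by apply: cont_on_comp cs edge_continuous _ => r; exact: std_edge.
have EA : E `<=` A by move=> _ [r /std_edge hr <-]; apply: sA; exists (edge r).
have E0 : E (s (delta_mx ord0 ord0)).
  exists 0; first by rewrite /= in_itv /= lexx ler01.
  by rewrite /= /edge subr0 scale1r scale0r addr0.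
have E1 : E (s (delta_mx ord0 ord_max)).
  exists 1; first by rewrite /= in_itv /= lexx ler01.
  by rewrite /= /edge subrr scale0r scale1r add0r.
have h x y : E x -> E y -> B x -> B y.
  move=> Ex Ey Bx; suff [] : (E `&` B) y by [].
  rewrite (cE (E `&` B))//; first by exists x.
  - exists C => //; rewrite BC setIA; congr (_ `&` _).
    by apply/seteqP; split=> z; [case|move=> Ez; split=> //; exact: EA].
  - exists C' => //; rewrite BC' setIA; congr (_ `&` _).
    by apply/seteqP; split=> z; [case|move=> Ez; split=> //; exact: EA].
by split; exact: h.
Qed.

(** Property H provides a bounding chain in [X]; excision at the point [x] moves it into [U]. *)
Lemma stalk_trivial_property_H n (U : set X) j : open U ->
  property_H R X n -> (j.+1 <= n)%N -> stalk_trivial U j.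
Proof.
move=> oU hH jn x c Ux cU cb.
have [|y yT hy] := property_H_kill hH jn _ cb.
  by apply: sub_supp cU => s; exact: sub_sing.
apply: (excision (B := setT) oU _ _ cU cb); last by exists y.
- by apply: accessible_closed_set1; apply: hausdorff_accessible; exact: metric_hausdorff.
- by move=> _ ->.
Qed.

(** A path from [a] to [b] is a 1-chain whose boundary misses [A]. Killing it on [A] leaves a
    1-chain in [W \ A] with the same boundary, and no such chain joins a relatively clopen set to
    its complement. *)
Lemma nonseparating n (A W : set X) : (1 <= n)%N -> property_H R X n.-1 ->
  closed A -> covdim_le A (n%:Z - 2) -> open W ->
  (forall a b, W a -> W b -> path_in W a b) -> connected (W `\` A).
Proof.
move=> n1 hH cA dA oW pW B [a Ba] oB cB.
apply: contrapT => BW.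
have BS : B `<=` W `\` A by case: oB => C _ -> x [].
have [b [Wb nAb] nBb] : exists2 b, (W `\` A) b & ~ B b.
  apply: contrapT => h; apply: BW; apply/seteqP; split=> // b Wb.
  by apply: contrapT => nBb; apply: h; exists b.
have [Wa nAa] := BS _ Ba.
have [f [cf f0 f1 fW]] := pW a b Wa Wb.
pose s : simplex 1 := fun t => f (t ord0 ord_max).
have s01 (t : 'rV[R]_2) : std_simplex t -> `[0, 1]%classic (t ord0 ord_max).
  move=> [t0 t1]; rewrite /= in_itv /= t0 /= -t1 big_ord_recl big_ord1.
  rewrite (_ : fintype.lift ord0 ord0 = ord_max) ?lerDr//; exact: val_inj.
have sW : singular_in W s.
  split; first by apply: cont_on_comp cf _ s01; exact: coord_continuous.
  by move=> _ [t /s01 st <-]; apply: fW; exists (t ord0 ord_max).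
pose c := sgen s.
have cW : supp (sing W (k:=1)) c by apply: supp_gen; exact: sing_nrm.
have bc : bd c = sgen (cst b) - sgen (cst a).
  by rewrite bd_sgen bds1 /s !mxE eqxx /= f0 f1.
have bA : supp (sing (~` A) (k:=0)) (bd c).
  by rewrite bc; apply: suppB; apply: supp_gen; exact: sing_cst.
have dA' : covdim_le A ((n.-1)%:Z - 1).
  by have -> : (n.-1)%:Z - 1 = n%:Z - 2 by lia.
have [|y yW hy] := @kill_closed _ _ W A n.-1 cA dA' 0 c _ cW bA.
  by move=> i hi; exact: (stalk_trivial_property_H oW hH).
pose e := c - bd y.
have eS : supp (sing (W `\` A) (k:=1)) e.
  have eW : supp (sing W (k:=1)) e by apply: suppB => //; exact: sing_bd.
  by apply: sub_supp (suppI eW hy) => t [h1 h2]; exact: singI.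
have be : bd e = bd c by rewrite /e bdB bdK subr0.
(* The number of points in [B], with multiplicity: it vanishes on boundaries of 1-chains in [W \ A]
   because edges are connected, but it is -1 on [b - a]. *)
pose chi : fab (simplex 0) -> int :=
  lin (fun t => (`[< B (t (delta_mx ord0 ord0)) >] : nat)%:Z).
have chi_cst x : chi (sgen (cst x)) = (`[< B x >] : nat)%:Z.
  by rewrite /chi /sgen lin_gen nrmE//; exact: std_vertex.
have chiB u v : chi (u - v) = chi u - chi v by exact: linB.
have h0 : chi (bd e) = 0.
  elim/fab_ind : eS => [|u v hu hv|t [nt ht]].
  - by rewrite bd0 /chi lin0.
  - by rewrite bdB chiB hu hv subrr.
  - rewrite /bd lin_gen bds1 chiB !chi_cst.
    have hB := clopen_simplex ht oB cB.
    by rewrite (asbool_equiv_eq hB) subrr.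
move: h0; rewrite be bc chiB !chi_cst.
by case: asboolP => // _; case: asboolP.
Qed.
End NonSeparation.

(** * Paths in complete locally connected spaces *)

Lemma iterated_choice (T : Type) (S : T -> Prop) (Q : nat -> T -> T -> Prop) t0 :
  S t0 -> (forall i t, S t -> exists2 t', S t' & Q i t t') ->
  exists f : nat -> T, [/\ f 0%N = t0, forall i, S (f i) & forall i, Q i (f i) (f i.+1)].
Proof.
move=> S0 SQ.
have /choice[g hg] (p : nat * T) : exists t', S p.2 -> S t' /\ Q p.1 p.2 t'.
  by have [/(SQ p.1)[t' St' Qt']|nS] := EM (S p.2); [exists t'|exists t0].
pose f := fix f i := if i is i'.+1 then g (i', f i') else t0.
have Sf i : S (f i) by elim: i => //= i /(hg (i, f i))[].
by exists f; split=> // i; have [] := hg (i, f i) (Sf i).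
Qed.

Lemma natSinv_lt (R : realType) (e : R) : 0 < e -> exists i, i.+1%:R^-1 < e.
Proof. by move=> e0; have [i _ /(_ i (leqnn i))] := near_infty_natSinv_lt (PosNum e0); exists i. Qed.

(** * Complete metric spaces: nested sets and Baire category *)

Section MetricSpace.
Variables (R : realType) (X : metricType R).

Definition diam_le (e : R) (B : set X) := forall x y, B x -> B y -> mdist x y <= e.

Lemma nbhs_mdistP (x : X) (W : set X) :
  nbhs x W <-> exists2 e : R, 0 < e & forall y, mdist x y < e -> W y.
Proof.
rewrite -nbhs_ballE; split=> -[e /= e0 eW]; exists e => //.
  by move=> y xy; apply: eW; rewrite ballEmdist.
by move=> y; rewrite ballEmdist => /eW.
Qed.

Lemma open_mdist_lt (x : X) (e : R) : open [set y | mdist x y < e].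
Proof.
rewrite openE => y /= xy; apply/nbhs_mdistP; exists (e - mdist x y).
  by rewrite subr_gt0.
move=> z yz /=; apply: le_lt_trans (metric_triangle _ y _) _.
by rewrite -ltrBrDl.
Qed.

Lemma open_mdist_gt (x : X) (e : R) : open [set y | e < mdist x y].
Proof.
rewrite openE => y /= xy; apply/nbhs_mdistP; exists (mdist x y - e).
  by rewrite subr_gt0.
move=> z yz /=; have := metric_triangle x z y; rewrite [mdist z y]metric_sym => h.
by rewrite -(ltrD2r (mdist y z)); apply: lt_le_trans h; rewrite -ltrBrDl.
Qed.

Lemma closed_mdist_le (x : X) (e : R) : closed [set y | mdist x y <= e].
Proof.
rewrite (_ : [set y | _] = ~` [set y | e < mdist x y]).
  by apply: open_closedC; exact: open_mdist_gt.
by apply/seteqP; split=> y /=; rewrite leNgt => /negP.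
Qed.

Lemma small_nbhs (x : X) (W : set X) (e : R) : nbhs x W -> 0 < e ->
  exists B, [/\ open B, B x, closure B `<=` W & diam_le e B].
Proof.
move=> /nbhs_mdistP[d d0 dW] e0.
pose r := Num.min (d / 2) (e / 2).
have r0 : 0 < r by rewrite lt_min !divr_gt0.
have rd : r < d by rewrite gt_min ltr_pdivrMr// ltr_pMr// ltr1n.
exists [set y | mdist x y < r]; split.
- exact: open_mdist_lt.
- by rewrite /= mdistxx.
- move=> y hy; apply: dW; apply: le_lt_trans rd.
  apply: (@closed_mdist_le x r); apply: closureS hy => z /=; exact: ltW.
- move=> y z /= xy xz; apply: le_trans (metric_triangle _ x _) _.
  rewrite [mdist y x]metric_sym [e]splitr; apply: lerD.
    by apply: le_trans (ltW xy) _; rewrite ge_min lexx orbT.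
  by apply: le_trans (ltW xz) _; rewrite ge_min lexx orbT.
Qed.

Hypothesis cX : complete_space X.

(** Cantor's intersection theorem for sets that need not be closed: each contains the closure of the
    next. *)
Lemma nested_point (B : nat -> set X) :
  (forall i, B i !=set0) -> (forall i, closure (B i.+1) `<=` B i) ->
  (forall i, diam_le i.+1%:R^-1 (B i.+1)) -> exists x, forall i, B i x.
Proof.
move=> /choice[u hu] cB dB.
have Bu i j : (i <= j)%N -> B i (u j).
  move=> ij; suff : B j `<=` B i by apply.
  elim: j ij => [|j IH]; first by rewrite leqn0 => /eqP->.
  rewrite leq_eqVlt => /predU1P[->//|/IH]; apply: subset_trans.
  by apply: subset_trans (cB j); exact: subset_closure.
have [|x ux] := cX (F := u @ \oo).
  apply: cauchy_exP => e /natSinv_lt[i ie]; exists (u i.+1).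
  exists i.+1 => // j /= ij; rewrite ballEmdist /=.
  by apply: le_lt_trans ie; apply: dB; apply: Bu.
exists x => i; apply: cB => W /ux [j _ hj].
exists (u (maxn j i.+1)); split; first by apply: Bu; exact: leq_maxr.
by apply: hj => /=; exact: leq_maxl.
Qed.

Lemma baire_category (F : nat -> set X) (U : set X) :
  (forall i, closed (F i)) ->
  (forall i V, open V -> V `<=` U -> V !=set0 -> V `\` F i !=set0) ->
  forall V, open V -> V `<=` U -> V !=set0 -> V `\` \bigcup_i F i !=set0.
Proof.
move=> cF hF V oV VU V0.
pose S (B : set X) := [/\ open B, B `<=` U & B !=set0].
pose Q i (B B' : set X) := [/\ closure B' `<=` B `\` F i & diam_le i.+1%:R^-1 B'].
have [||B [B0 SB QB]] := @iterated_choice _ S Q V.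
- by split.
- move=> i B [oB BU Bn0]; have [x [Bx nFx]] := hF i B oB BU Bn0.
  have nx : nbhs x (B `\` F i).
    by apply: open_nbhs_nbhs; split=> //; apply: openI => //; exact: closed_openC.
  have [|B' [oB' B'x B'B dB']] := small_nbhs nx (e := i.+1%:R^-1).
    by rewrite invr_gt0 ltr0n.
  exists B'; split=> //; last by exists x.
  by move=> y /subset_closure/B'B[/BU].
have [|||x hx] := nested_point (B := B).
- by move=> i; case: (SB i).
- by move=> i; have [h _] := QB i; move=> y /h[].
- by move=> i; case: (QB i).
exists x; split; first by rewrite -B0.
by move=> [i _ Fx]; have [h _] := QB i; have [] := h _ (subset_closure (hx i.+1)).
Qed.
End MetricSpace.

(** * Chains of small connected open sets *)

Section Chains.
Variables (R : realType) (X : metricType R).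
Hypotheses (cX : complete_space X) (lX : locally_connected X).
Variables (F : nat -> set X) (U : set X).
Hypotheses (cF : forall i, closed (F i)) (oU : open U) (cU : connected U).
Hypothesis sepU : forall i A W, closed A -> A `<=` F i ->
  open W -> connected W -> W `<=` U -> connected (W `\` A).
Local Notation G := (U `\` \bigcup_i F i).
Hypothesis G0 : G !=set0.

(* A sphere inside F i would separate U. *)
Lemma nowhere_dense i V : open V -> V `<=` U -> V !=set0 -> V `\` F i !=set0.
Proof.
move=> oV VU [y Vy]; apply: contrapT => /set0P/negP/negPn/eqP VF.
have {}VF : V `<=` F i.
  move=> z Vz; apply: contrapT => nFz.
  by have : (V `\` F i) z by []; rewrite VF.
have [g [Ug nFg]] := G0.
have /nbhs_mdistP[e e0 eV] : nbhs y V by exact: open_nbhs_nbhs.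
have e2 : e / 2 < e by rewrite ltr_pdivrMr// ltr_pMr// ltr1n.
pose A := [set z | mdist y z <= e / 2] `\` [set z | mdist y z < e / 2].
have cA : closed A.
  by apply: closedI; [exact: closed_mdist_le|apply: open_closedC; exact: open_mdist_lt].
have AF : A `<=` F i.
  by rewrite /A => z [/= yz _]; apply/VF/eV; exact: le_lt_trans e2.
have far : e / 2 < mdist y g.
  rewrite ltNge; apply/negP => yg; apply: nFg; exists i => //.
  by apply/VF/eV; exact: le_lt_trans e2.
(* Off the sphere [A], the open and the closed ball coincide, so the ball is clopen in [U \ A]; by
   connectedness it is everything, yet [g] lies outside. *)
have E : (U `\` A) `&` [set z | mdist y z < e / 2] = U `\` A.
  apply: (sepU cA AF oU cU (fun _ h => h)).
  - exists y; have y0 : mdist y y < e / 2 by rewrite mdistxx divr_gt0.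
    by split=> //; split; [exact: VU|rewrite /A => -[_]; apply].
  - by exists [set z | mdist y z < e / 2] => //; exact: open_mdist_lt.
  - exists [set z | mdist y z <= e / 2]; first exact: closed_mdist_le.
    apply/seteqP; split=> z [[Uz nAz] /= yz]; split=> //=; first exact: ltW.
    by apply: contrapT => h; exact: nAz.
have : (U `\` A) g by split=> //; rewrite /A => -[/=]; rewrite leNgt far.
by rewrite -E => -[_ /= h]; move: far; rewrite ltNge (ltW h).
Qed.

Lemma dense_G V : open V -> V `<=` U -> V !=set0 -> V `&` G !=set0.
Proof.
move=> oV VU V0.
have [x [Vx nFx]] := baire_category cX cF (fun i V => @nowhere_dense i V) oV VU V0.
by exists x; split=> //; split=> //; exact: VU.
Qed.

(** The closure, not just [V], lies in [W \ F i]; this supplies the nesting needed for limits. *)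
Definition link i (e : R) (W V : set X) :=
  [/\ open V, connected V, closure V `<=` W `\` F i & diam_le e V].

Lemma link_at i e W x : 0 < e -> open W -> W x -> ~ F i x ->
  exists2 V, link i e W V & V x.
Proof.
move=> e0 oW Wx nFx.
have nx : nbhs x (W `\` F i).
  by apply: open_nbhs_nbhs; split=> //; apply: openI => //; exact: closed_openC.
have [B [oB Bx BW dB]] := small_nbhs nx e0.
have [V [oV Vx cV VB]] := lX (open_nbhs_nbhs (conj oB Bx)).
exists V => //; split=> //; first by apply: subset_trans BW; exact: closureS.
by move=> y z /VB By /VB; exact: dB.
Qed.

(** The nodes are in [G], hence off all the [F j], so that the next refinement can start from
    them. *)
Definition chained i e W x z m := exists (y : nat -> X) (V : nat -> set X),
  [/\ y 0%N = x, y m = z, forall s, (s <= m)%N -> G (y s) &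
      forall s, (s < m)%N -> [/\ link i e W (V s), V s (y s) & V s (y s.+1)]].

Lemma chained_rcons i e W x y z m V : G z -> chained i e W x y m ->
  link i e W V -> V y -> V z -> chained i e W x z m.+1.
Proof.
move=> Gz [u [C [u0 um Gu hC]]] lV Vy Vz.
exists (fun s => if (s <= m)%N then u s else z), (fun s => if (s < m)%N then C s else V).
split=> //; first by rewrite ltnn.
  by move=> s _; case: ifP => // /Gu.
move=> s; rewrite ltnS => sm1.
have /predU1P[->|sm] : (s == m) || (s < m)%N by rewrite -leq_eqVlt.
  by rewrite ltnn ?leqnn um.
by rewrite sm (ltnW sm); exact: hC.
Qed.

(** The points lying in a link with a reachable node form a relatively clopen subset of the
    connected set [W \ F i]. A chain can be prolonged by repeating its last node, so all large
    lengths occur and the links of a longer chain can be refined by equal numbers. *)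
Lemma chain_exists i e W x z : 0 < e -> open W -> connected W -> W `<=` U ->
  W x -> W z -> G x -> G z ->
  exists m0, forall m, (m0 <= m)%N -> chained i e W x z m.
Proof.
move=> e0 oW cW WU Wx Wz Gx Gz.
pose reach z := exists m0, forall m, (m0 <= m)%N -> chained i e W x z m.
have nF w : G w -> ~ F i w by move=> [_ h] Fw; apply: h; exists i.
have reach_link y w V : reach y -> G w -> link i e W V -> V y -> V w -> reach w.
  move=> [m0 h] Gw lV Vy Vw; exists m0.+1 => -[//|m] mm.
  by apply: chained_rcons Gw (h m mm) lV Vy Vw.
have reach_x : reach x.
  have [V lV Vx] := link_at e0 oW Wx (nF _ Gx).
  by exists 0%N => m _; exists (fun=> x), (fun=> V); split.
pose E := [set w | (W `\` F i) w /\
  exists V g, [/\ link i e W V, V w, V g, G g & reach g]].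
have linkW V w : link i e W V -> V w -> (W `\` F i) w.
  by move=> [_ _ h _] Vw; apply: h; exact: subset_closure.
have E_adh w : (W `\` F i) w -> closure E w -> E w.
  move=> [Ww nFw] cEw; split=> //.
  have [V lV Vw] := link_at e0 oW Ww nFw.
  have [oV _ _ _] := lV.
  have [w' [[_ [V' [g [lV' V'w' V'g Gg rg]]]] Vw']] := cEw V (open_nbhs_nbhs (conj oV Vw)).
  have [oV' _ _ _] := lV'.
  (* The overlap of two links need not consist of points of [G]; density provides a node in it. *)
  have [|||g' [[Vg' V'g'] Gg']] := @dense_G (V `&` V').
  - exact: openI.
  - by move=> u [/(linkW _ _ lV)[/WU]].
  - by exists w'.
  by exists V, g'; split=> //; exact: (reach_link g g' V').
suff EE : E = W `\` F i.
  have : (W `\` F i) z by split=> //; exact: nF.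
  by rewrite -EE => -[_ [V [g [lV Vz Vg _ rg]]]]; exact: (reach_link g z V).
apply: (sepU (@cF i) (fun _ h => h) oW cW WU).
- exists x; split; first by split=> //; exact: nF.
  by have [V lV Vx] := link_at e0 oW Wx (nF _ Gx); exists V, x.
- exists E; last by apply/seteqP; split=> w; [move=> Ew; split=> //; case: Ew|case].
  rewrite openE => w [_ [V [g [lV Vw Vg Gg rg]]]]; have [oV _ _ _] := lV.
  apply: (@filterS _ _ (nbhs_filter w) V); last exact: open_nbhs_nbhs.
  by move=> w' Vw'; split; [exact: linkW lV Vw'|exists V, g].
- exists (closure E); first exact: closed_closure.
  apply/seteqP; split=> w; last by case=> ? ?; exact: E_adh.
  by move=> Ew; split; [case: Ew|exact: subset_closure].
Qed.

(* Number of links, nodes and links of a chain. *)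
Definition chain_data : Type := nat * (nat -> X) * (nat -> set X).

Definition is_chain a b (c : chain_data) := let: (k, x, V) := c in
  [/\ (0 < k)%N, x 0%N = a, x k = b, forall j, (j <= k)%N -> G (x j) &
   forall j, (j < k)%N -> [/\ open (V j), connected (V j), V j `<=` U, V j (x j) & V j (x j.+1)]].

(** Each link is replaced by the same number [m] of links, so link [q] of the new chain lies over
    link [q %/ m] of the old one. *)
Definition refines i (e : R) (c c' : chain_data) :=
  let: (k, x, V) := c in let: (k', x', V') := c' in
  exists2 m, (0 < m)%N /\ k' = (k * m)%N &
    forall q, (q < k')%N -> closure (V' q) `<=` V (q %/ m)%N `\` F i /\ diam_le e (V' q).

Lemma refine_chain a b i e c : 0 < e -> is_chain a b c ->
  exists2 c', is_chain a b c' & refines i e c c'.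
Proof.
case: c => -[k x] V e0 [k0 x0 xk Gx hV].
have /choice[m0 hm0] j : exists m0, (j < k)%N ->
    forall m, (m0 <= m)%N -> chained i e (V j) (x j) (x j.+1) m.
  have [jk|jk] := boolP (j < k)%N; last by exists 0%N.
  have [oV cV VU Vx Vx'] := hV j jk.
  have [m0 h] := chain_exists i e0 oV cV VU Vx Vx' (Gx _ (ltnW jk)) (Gx _ jk).
  by exists m0.
pose m := (\max_(j < k) m0 j).+1.
have hm j : (j < k)%N -> chained i e (V j) (x j) (x j.+1) m.
  move=> jk; apply: hm0 => //; apply: leqW.
  exact: (leq_bigmax (Ordinal jk) : m0 (Ordinal jk) <= _)%N.
have /choice[p hp] j : exists p : (nat -> X) * (nat -> set X), (j < k)%N ->
  [/\ p.1 0%N = x j, p.1 m = x j.+1, forall s, (s <= m)%N -> G (p.1 s) &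
      forall s, (s < m)%N -> [/\ link i e (V j) (p.2 s), p.2 s (p.1 s) & p.2 s (p.1 s.+1)]].
  have [/hm[y [C hC]]|jk] := boolP (j < k)%N; first by exists (y, C).
  by exists (x, V).
have m_gt0 : (0 < m)%N by [].
(* The default [b] is the final node, at [q = k * m], where no link begins. *)
pose x' q := if (q %/ m < k)%N then (p (q %/ m)%N).1 (q %% m)%N else b.
pose V' q := (p (q %/ m)%N).2 (q %% m)%N.
have qm q : (q < k * m)%N -> (q %/ m < k)%N by rewrite ltn_divLR.
have x'S q : (q < k * m)%N -> x' q.+1 = (p (q %/ m)%N).1 (q %% m).+1.
  move=> qk; have [hp0 hp1 _ _] := hp _ (qm _ qk).
  have [sm|sm] := ltnP (q %% m).+1 m.
    have E : q.+1 = ((q %/ m) * m + (q %% m).+1)%N by rewrite addnS -divn_eq.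
    by rewrite /x' E divnMDl// (divn_small sm) addn0 qm// modnMDl (modn_small sm).
  have sE : (q %% m).+1 = m by apply/eqP; rewrite eqn_leq sm andbT ltn_mod.
  have E : q.+1 = ((q %/ m).+1 * m)%N by rewrite {1}(divn_eq q m) -addnS sE mulSn addnC.
  rewrite /x' E mulnK// modnMl sE hp1; case: ltnP => [jk|kj].
    by have [-> _ _ _] := hp _ jk.
  by rewrite -xk; congr x; apply/eqP; rewrite eqn_leq kj qm.
exists ((k * m)%N, x', V'); last first.
  exists m => // q qk; have [_ _ _ hl] := hp _ (qm _ qk).
  by have [[]] := hl (q %% m)%N (ltn_pmod _ m_gt0).
split.
- by rewrite muln_gt0 k0.
- by rewrite /x' div0n k0 mod0n; have [-> _ _ _] := hp _ k0.
- by rewrite /x' mulnK// ltnn.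
- move=> q _; rewrite /x'; case: ifP => [/hp[_ _ h _]|_].
    by apply: h; apply: ltnW; rewrite ltn_mod.
  by rewrite -xk; exact: Gx.
- move=> q qk; have [_ _ _ hl] := hp _ (qm _ qk).
  have [[oV' cV' V'V _] V'x V'x'] := hl (q %% m)%N (ltn_pmod _ m_gt0).
  have [_ _ VU _ _] := hV _ (qm _ qk).
  split=> //; first by move=> w /subset_closure/V'V[/VU].
    by rewrite /x' qm.
  by rewrite x'S.
Qed.
End Chains.

(** * Nested grids on the parameter interval *)

Section Grid.
Variable R : realType.
Implicit Types (s t : R) (k m : nat).

(* The minimum puts the end point 1 in the last of the k parts of [0, 1]. *)
Definition cell k t : nat := minn (Num.truncn (t * k%:R)) k.-1.

Lemma cell_lt k t : (0 < k)%N -> (cell k t < k)%N.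
Proof. by move=> k0; rewrite /cell gtn_min (ltn_predL k) k0 orbT. Qed.

Lemma cell0 k : cell k 0 = 0%N.
Proof. by rewrite /cell mul0r truncn0 min0n. Qed.

Lemma cell1 k : cell k 1 = k.-1.
Proof. by rewrite /cell mul1r natrK; apply/minn_idPr; exact: leq_pred. Qed.

Lemma truncn_divn t m : 0 <= t -> (0 < m)%N ->
  (Num.truncn (t * m%:R) %/ m)%N = Num.truncn t.
Proof.
move=> t0 m0; have mR : 0 < m%:R :> R by rewrite ltr0n.
have /andP[h1 h2] := truncn_itv (mulr_ge0 t0 (ltW mR)).
set q := Num.truncn _ in h1 h2 *; apply/esym/truncn_def; apply/andP; split.
  rewrite -(ler_pM2r mR); apply: le_trans h1.
  by rewrite -natrM ler_nat leq_divM.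
rewrite -(ltr_pM2r mR); apply: lt_le_trans h2 _.
by rewrite -natrM ler_nat -ltn_divLR.
Qed.

(** Truncation at the finer scale followed by division is truncation at the coarser scale, and the
    cap at the last cell is compatible with division. Parameter cells thus nest exactly as links do
    in [refines]. *)
Lemma cell_refine k m t : 0 <= t -> (0 < k)%N -> (0 < m)%N ->
  (cell (k * m) t %/ m)%N = cell k t.
Proof.
move=> t0 k0 m0; rewrite /cell natrM mulrA.
have E : ((k * m).-1 %/ m)%N = k.-1.
  rewrite -{1}(prednK k0) mulSn -{1}(prednK m0) addSn /= addnC.
  by rewrite divnMDl// divn_small ?addn0// prednK.
rewrite -(truncn_divn (t := t * k%:R) _ m0) ?mulr_ge0// -E.
by case: (leqP (Num.truncn (t * k%:R * m%:R)) (k * m).-1) => h;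
  [rewrite (minn_idPl (leq_div2r m h))|rewrite (minn_idPr (leq_div2r m (ltnW h)))].
Qed.

Lemma le_cell k s t : s <= t -> (cell k s <= cell k t)%N.
Proof.
move=> st; rewrite /cell leq_min geq_minr andbT; apply: leq_trans (geq_minl _ _) _.
by apply: le_truncn; rewrite ler_wpM2r.
Qed.

Lemma cell_near k s t : 0 <= s -> (0 < k)%N -> t - s < k%:R^-1 ->
  (cell k t <= (cell k s).+1)%N.
Proof.
move=> s0 k0; have kR : 0 < k%:R :> R by rewrite ltr0n.
rewrite ltrBlDr -(ltr_pM2r kR) mulrDl mulVf ?gt_eqF// => h.
have h2 : (Num.truncn (t * k%:R) <= (Num.truncn (s * k%:R)).+1)%N.
  have /andP[_ h1] := truncn_itv (mulr_ge0 s0 (ltW kR)).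
  rewrite -ltnS; have [t0|t0] := leP 0 (t * k%:R); last first.
    by rewrite (_ : Num.truncn _ = 0%N)//; apply/truncn0Pn; rewrite -ltNge (lt_trans t0).
  rewrite truncn_lt_nat//; apply: lt_trans h _.
  by rewrite -[(Num.truncn _).+2]add1n natrD ltrD2l.
rewrite /cell; case: (leqP (Num.truncn (s * k%:R)) k.-1) => h'; first by rewrite geq_min h2.
by apply: leqW; exact: geq_minr.
Qed.
End Grid.

Section Paths.
Variables (R : realType) (X : metricType R).
Hypotheses (cX : complete_space X) (lX : locally_connected X).

Lemma path_avoiding (F : nat -> set X) (U : set X) :
  (forall i, closed (F i)) -> open U -> connected U ->
  (forall i A W, closed A -> A `<=` F i ->
    open W -> connected W -> W `<=` U -> connected (W `\` A)) ->
  forall a b, (U `\` \bigcup_i F i) a -> (U `\` \bigcup_i F i) b ->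
  path_in (U `\` \bigcup_i F i) a b.
Proof.
move=> cF oU cU sepU a b Ga Gb; set G := U `\` _ in Ga Gb *.
have G0 : G !=set0 by exists a.
(* The initial chain has [U] itself as its only link. *)
pose c0 : chain_data X := (1%N, fun j => if j == 0%N then a else b, fun=> U).
have [||c [cc0 Sc Qc]] := @iterated_choice _ (is_chain F U a b)
    (fun i => refines F i (i.+1%:R^-1 : R)) c0.
- split=> //; first by move=> j _; case: ifP.
  by case=> // _; split=> //=; [case: Ga|case: Gb].
- move=> i c hc; apply: (refine_chain cX lX cF oU cU sepU G0) hc.
  by rewrite invr_gt0 ltr0n.
pose k i := (c i).1.1; pose x i := (c i).1.2; pose V i := (c i).2.
have hS i : [/\ (0 < k i)%N, x i 0%N = a, x i (k i) = b &
    forall j, (j < k i)%N -> V i j (x i j) /\ V i j (x i j.+1)].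
  rewrite /k /x /V; have := Sc i; case: (c i) => -[k' x'] V' [k0 x0 xk _ hV].
  by split=> // j /hV[].
have hQ i : exists2 m, (0 < m)%N /\ k i.+1 = (k i * m)%N &
    forall q, (q < k i.+1)%N -> closure (V i.+1 q) `<=` V i (q %/ m)%N `\` F i /\
      diam_le i.+1%:R^-1 (V i.+1 q).
  by rewrite /k /x /V; have := Qc i; case: (c i) (c i.+1) => -[? ?] ? [[? ?] ?].
have kgt0 i : (0 < k i)%N by case: (hS i).
have hB i (t : R) : 0 <= t -> closure (V i.+1 (cell (k i.+1) t)) `<=`
    V i (cell (k i) t) `\` F i /\ diam_le i.+1%:R^-1 (V i.+1 (cell (k i.+1) t)).
  move=> t0; have [m [m0 km] hm] := hQ i; have := hm _ (cell_lt t (kgt0 i.+1)).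
  by rewrite {2}km cell_refine.
(* [f t] is the common point of the links whose cells contain [t]. *)
have /choice[f hf] (t : R) : exists y, 0 <= t -> forall i, V i (cell (k i) t) y.
  have [t0|t0] := boolP (0 <= t); last by exists a.
  have [|||y hy] := nested_point cX (B := fun i => V i (cell (k i) t)).
  - move=> i; have [_ _ _ h] := hS i; exists (x i (cell (k i) t)).
    by have [] := h _ (cell_lt t (kgt0 i)).
  - by move=> i; have [h _] := hB i t t0; move=> z /h[].
  - by move=> i; have [] := hB i t t0.
  by exists y.
have small (y z : X) : (forall i, mdist y z <= i.+1%:R^-1) -> y = z.
  move=> h; have [//|] := eqVneq y z; rewrite -mdist_gt0 => /natSinv_lt[i].
  by rewrite ltNge h.
exists f; split.
- apply/cont_onP => t; rewrite /= in_itv /= => /andP[t0 _] W /nbhs_mdistP[e e0 eW].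
  have [i ie] := natSinv_lt (divr_gt0 e0 (ltr0Sn R 1)).
  have kR : 0 < (k i.+1)%:R^-1 :> R by rewrite invr_gt0 ltr0n.
  exists (k i.+1)%:R^-1 => //= s st; rewrite in_itv /= => /andP[s0 _]; apply: eW.
  have close u v : 0 <= u -> u <= v -> v - u < (k i.+1)%:R^-1 -> mdist (f u) (f v) < e.
    move=> u0 uv huv; have v0 := le_trans u0 uv.
    have [_ du] := hB i u u0; have [_ dv] := hB i v v0.
    have ju := cell_lt u (kgt0 i.+1); have jv := cell_lt v (kgt0 i.+1).
    have [_ _ _ hx] := hS i.+1.
    (* Nearby parameters lie in equal or adjacent cells, whose links share a node; two link
       diameters then bound the distance of the values. *)
    have [y [Vy Vy']] : exists y, V i.+1 (cell (k i.+1) u) y /\ V i.+1 (cell (k i.+1) v) y.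
      have := cell_near u0 (kgt0 i.+1) huv; rewrite leq_eqVlt => /predU1P[E|].
        exists (x i.+1 (cell (k i.+1) v)); split; last by case: (hx _ jv).
        by rewrite E; case: (hx _ ju).
      rewrite ltnS => h.
      have -> : cell (k i.+1) v = cell (k i.+1) u.
        by apply/eqP; rewrite eqn_leq h le_cell.
      by exists (x i.+1 (cell (k i.+1) u)); case: (hx _ ju).
    apply: le_lt_trans (metric_triangle _ y _) _; rewrite [e]splitr.
    apply: ltrD; apply: le_lt_trans ie.
      by apply: du => //; exact: hf.
    by apply: dv => //; exact: hf.
  have [ts|st'] := leP t s.
    apply: close => //; apply: le_lt_trans st.
    by rewrite -normrN opprB ler_norm.
  rewrite metric_sym; apply: close => //; first exact: ltW.
  by apply: le_lt_trans st; rewrite ler_norm.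
- apply: small => i; have [_ d] := hB i 0 (lexx 0).
  have [_ xa _ hx] := hS i.+1; apply: d; first exact: hf.
  by rewrite cell0 -xa; case: (hx _ (kgt0 i.+1)).
- apply: small => i; have [_ d] := hB i 1 ler01.
  have [_ _ xb hx] := hS i.+1; apply: d; first exact: hf.
  rewrite cell1 -xb; have kp := prednK (kgt0 i.+1).
  have [|_] := hx (k i.+1).-1; first by rewrite kp.
  by rewrite kp.
- move=> y [t]; rewrite /= in_itv /= => /andP[t0 _] <-; split.
    by have := hf t t0 0%N; rewrite /V cc0.
  move=> [i _ Fi]; have [h _] := hB i t t0.
  by have [] := h _ (subset_closure (hf t t0 i.+1)).
Qed.

Lemma path_connected_open (W : set X) : open W -> connected W ->
  forall a b, W a -> W b -> path_in W a b.
Proof.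
move=> oW cW a b Wa Wb.
have E : W `\` \bigcup_(i : nat) (set0 : set X) = W by rewrite bigcup0// setD0.
rewrite -E; apply: path_avoiding => //; rewrite ?E//.
- by move=> _; exact: closed0.
- move=> _ A W' _ A0 _ cW' _; suff -> : A = set0 by rewrite setD0.
  by apply/seteqP; split.
Qed.
End Paths.

(** * From paths to arcs *)

Section MonotoneReparametrisation.
Variables (R : realType) (X : metricType R) (h : R -> X).
Hypothesis ch : continuous h.

Lemma cont_mdist t e : 0 < e ->
  exists2 d, 0 < d & forall u, `|t - u| < d -> mdist (h t) (h u) < e.
Proof.
move=> e0; have /(@ch t)[d /= d0 hd] : nbhs (h t) [set y | mdist (h t) y < e].
  by apply/nbhs_mdistP; exists e.
by exists d.
Qed.

(* Countably many functions, of which one vanishes on a given compact set but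
   not at a given point h t outside of it. *)
Definition bump_fun (n : nat) (x : X) : R :=
  if unpickle n is Some (q, k) then
    Num.max 0 ((k : nat).+1%:R^-1 - mdist x (h (ratr (q : rat)))) else 0.

Lemma bump_fun_ge0 n x : 0 <= bump_fun n x.
Proof. by rewrite /bump_fun; case: unpickle => [[q k]|]//; rewrite le_max lexx. Qed.

Lemma bump_fun_le1 n x : bump_fun n x <= 1.
Proof.
rewrite /bump_fun; case: unpickle => [[q k]|]; last exact: ler01.
rewrite ge_max ler01 lerBlDr; apply: (@le_trans _ _ 1).
  by rewrite invf_le1 ?ltr0n// ler1n.
by rewrite lerDl mdist_ge0.
Qed.

Lemma bump_fun_lip n x y : bump_fun n x <= bump_fun n y + mdist y x.
Proof.
rewrite /bump_fun; case: unpickle => [[q k]|]; last by rewrite add0r mdist_ge0.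
rewrite ge_max addr_ge0 ?mdist_ge0 ?le_max ?lexx//=.
set c := k.+1%:R^-1; set p := h _.
apply: (@le_trans _ _ (c - mdist y p + mdist y x)); last first.
  by rewrite lerD2r le_max lexx orbT.
have := metric_triangle y x p; lra.
Qed.

Definition run_sup n t : R := sup [set bump_fun n (h u) | u in `[0, t]%classic].

Lemma run_sup_ge n t u : 0 <= u <= t -> bump_fun n (h u) <= run_sup n t.
Proof.
move=> ut; apply: ub_le_sup; last by exists u => //=; rewrite in_itv.
by exists 1 => _ [v _ <-]; exact: bump_fun_le1.
Qed.

Lemma run_sup_le n t c : 0 <= t -> (forall u, 0 <= u <= t -> bump_fun n (h u) <= c) ->
  run_sup n t <= c.
Proof.
move=> t0 hc; apply: ge_sup; last first.
  by move=> y [u /=]; rewrite in_itv /= => /hc + <-.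
by exists (bump_fun n (h 0)), 0 => //=; rewrite in_itv /= lexx.
Qed.

Lemma run_sup_mono n s t : 0 <= s -> s <= t -> run_sup n s <= run_sup n t.
Proof.
move=> s0 st; apply: run_sup_le => // u /andP[u0 us].
by apply: run_sup_ge; rewrite u0 (le_trans us).
Qed.

Lemma run_sup_step n s t e : 0 <= s -> s <= t ->
  (forall u, s <= u <= t -> mdist (h s) (h u) <= e) ->
  run_sup n t <= run_sup n s + e.
Proof.
move=> s0 st he; have e0 : 0 <= e.
  by apply: le_trans (he s _); rewrite ?mdist_ge0// lexx.
apply: run_sup_le => [|u /andP[u0 ut]]; first exact: le_trans st.
have [us|su] := leP u s.
  by apply: le_trans (run_sup_ge n (t := s) _) _; rewrite ?u0 ?us// lerDl.
apply: le_trans (bump_fun_lip n (h u) (h s)) _; apply: lerD.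
  by apply: run_sup_ge; rewrite s0 lexx.
by apply: he; rewrite (ltW su).
Qed.

Lemma run_sup_ge0 n t : 0 <= t -> 0 <= run_sup n t.
Proof.
by move=> t0; apply: le_trans (run_sup_ge n (u := 0) _); rewrite ?bump_fun_ge0// lexx.
Qed.

Lemma run_sup_le1 n t : 0 <= t -> run_sup n t <= 1.
Proof. by move=> t0; apply: run_sup_le => // u _; exact: bump_fun_le1. Qed.

Definition wsum N t : R := \sum_(n < N) 2^-1 ^+ n.+1 * run_sup n t.

Lemma sum_weights N : \sum_(n < N) (2^-1 : R) ^+ n.+1 <= 1.
Proof.
have -> : \sum_(n < N) (2^-1 : R) ^+ n.+1 = 1 - 2^-1 ^+ N.
  elim: N => [|N IH]; first by rewrite big_ord0 expr0 subrr.
  rewrite big_ord_recr /= IH exprS.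
  by field.
by rewrite lerBlDr lerDl exprn_ge0.
Qed.

Lemma wsum_le N s t e : 0 <= e -> (forall n, run_sup n t <= run_sup n s + e) ->
  wsum N t <= wsum N s + e.
Proof.
move=> e0 he; apply: (@le_trans _ _ (\sum_(n < N) 2^-1 ^+ n.+1 * (run_sup n s + e))).
  by apply: ler_sum => n _; rewrite ler_wpM2l// exprn_ge0.
under eq_bigr do rewrite mulrDr; rewrite big_split /= lerD2l -mulr_suml.
by rewrite ler_piMl// sum_weights.
Qed.

(** A weighted sum of the running maxima of all bump functions, as a supremum of partial sums. When
    the fibres of [h] are intervals, it is a monotone real function with the same fibres. The
    weights total at most 1, so it varies no more than [h] does. *)
Definition height t : R := sup [set wsum N t | N in [set: nat]].

Lemma height_ge N t : 0 <= t -> wsum N t <= height t.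
Proof.
move=> t0; apply: ub_le_sup; last by exists N.
exists 1 => _ [K _ <-]; apply: le_trans (sum_weights K).
by apply: ler_sum => n _; rewrite ler_piMr ?exprn_ge0// run_sup_le1.
Qed.

Lemma height_le t c : (forall N, wsum N t <= c) -> height t <= c.
Proof.
by move=> hc; apply: ge_sup; [exists (wsum 0 t), 0%N|move=> _ [N _ <-]].
Qed.

Lemma height_step s t e : 0 <= s -> s <= t ->
  (forall u, s <= u <= t -> mdist (h s) (h u) <= e) -> height t <= height s + e.
Proof.
move=> s0 st he; have e0 : 0 <= e.
  by apply: le_trans (he s _); rewrite ?mdist_ge0// lexx.
apply: height_le => N; apply: le_trans (wsum_le N e0 _) _.
  by move=> n; exact: run_sup_step he.
by rewrite lerD2r; exact: height_ge.
Qed.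

Lemma height_mono s t : 0 <= s -> s <= t -> height s <= height t.
Proof.
move=> s0 st; apply: height_le => N; apply: le_trans (height_ge N (le_trans s0 st)).
by apply: ler_sum => n _; rewrite ler_wpM2l ?exprn_ge0// run_sup_mono.
Qed.

Lemma height_strict n s t : 0 <= s -> s <= t -> run_sup n s < run_sup n t ->
  height s < height t.
Proof.
move=> s0 st hn; pose c := 2^-1 ^+ n.+1 * (run_sup n t - run_sup n s).
have c0 : 0 < c by rewrite mulr_gt0 ?exprn_gt0// subr_gt0.
suff : height s <= height t - c by move/le_lt_trans; apply; rewrite gtrBl.
apply: height_le => N; rewrite lerBrDr.
(* The partial sum is lengthened until it contains the term [n], which alone accounts for the gain
   [c]. *)
apply: (@le_trans _ _ (wsum (maxn N n.+1) t)); last first.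
  by apply: height_ge; exact: le_trans st.
apply: (@le_trans _ _ (wsum (maxn N n.+1) s + c)).
  rewrite lerD2r /wsum -(big_mkord xpredT (fun n => 2^-1 ^+ n.+1 * run_sup n s)).
  rewrite -(big_mkord xpredT (fun n => 2^-1 ^+ n.+1 * run_sup n s)).
  rewrite (@big_cat_nat _ _ _ N 0 (maxn N n.+1))//= ?leq_maxl//.
  rewrite lerDl sumr_ge0// => i _.
  by rewrite mulr_ge0 ?exprn_ge0// run_sup_ge0.
have nK : (n < maxn N n.+1)%N by rewrite leq_maxr.
rewrite /wsum (bigD1 (Ordinal nK))//= [leRHS](bigD1 (Ordinal nK))//=.
rewrite addrAC lerD//; first by rewrite -mulrDr addrC subrK.
by apply: ler_sum => i _; rewrite ler_wpM2l ?exprn_ge0// run_sup_mono.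
Qed.

Hypothesis mono : forall s u t, 0 <= s -> s <= u -> u <= t -> t <= 1 ->
  h s = h t -> h u = h s.

Lemma height_eqP s t : 0 <= s -> s <= t -> t <= 1 -> height s = height t <-> h s = h t.
Proof.
move=> s0 st t1; split=> [|hst]; last first.
  apply/eqP; rewrite eq_le height_mono//= -[height s]addr0.
  by apply: height_step => // u /andP[su ut]; rewrite (mono s0 su ut t1 hst) mdistxx.
move=> E; apply: contrapT => hst.
pose K := h @` `[0, s]%classic.
have cK : compact K.
  apply: continuous_compact; last exact: segment_compact.
  exact: continuous_subspaceT.
have nK : ~ K (h t).
  move=> [v /=]; rewrite in_itv /= => /andP[v0 vs] hvt; apply: hst.
  by rewrite (mono v0 vs st t1 hvt).
have /nbhs_mdistP[e e0 eK] : nbhs (h t) (~` K).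
  apply: open_nbhs_nbhs; split=> //; apply: closed_openC.
  by apply: compact_closed => //; exact: metric_hausdorff.
(* The bump has radius [r < e / 2] and a centre within [r] of [h t]. Points of [K] are at least [e]
   from [h t], hence more than [r] from the centre, so the bump vanishes on [K] and is positive at
   [h t]. *)
have [k ke] := natSinv_lt (divr_gt0 e0 (ltr0Sn R 1)).
set r := k.+1%:R^-1 in ke.
have r0 : 0 < r :> R by rewrite invr_gt0 ltr0n.
have [d d0 hd] := cont_mdist t r0.
have [q] : exists q, ratr q \in `]t, (t + d)[%R by apply: rat_in_itvoo; rewrite ltrDl.
rewrite in_itv /= => /andP[tq qd].
have htq : mdist (h t) (h (ratr q)) < r.
  by apply: hd; rewrite distrC gtr0_norm ?subr_gt0// ltrBlDl.
have [n hn] : exists n, forall x, bump_fun n x = Num.max 0 (r - mdist x (h (ratr q))).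
  by exists (pickle (q, k)) => x; rewrite /bump_fun pickleK.
suff /(height_strict s0 st) : run_sup n s < run_sup n t by rewrite E ltxx.
apply: (@le_lt_trans _ _ 0).
  apply: run_sup_le => // u /andP[u0 us]; rewrite hn ge_max lexx /=.
  have eu : e <= mdist (h t) (h u).
    rewrite leNgt; apply/negP => /eK; apply; exists u => //=.
    by rewrite in_itv /= u0.
  have := metric_triangle (h t) (h (ratr q)) (h u).
  rewrite [mdist (h (ratr q)) _]metric_sym; lra.
apply: lt_le_trans (run_sup_ge n (u := t) _); last by rewrite (le_trans s0 st) lexx.
by rewrite hn lt_max subr_gt0 htq orbT.
Qed.

Lemma height_continuous : {within `[0, 1]%classic, continuous height}.
Proof.
apply/cont_onP => t; rewrite /= in_itv /= => /andP[t0 t1] W [e /= e0 eW].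
have [|d d0 hd] := cont_mdist t (e := e / 2 / 2); first by rewrite !divr_gt0.
have near u v : 0 <= u -> u <= v -> `|t - u| < d -> `|t - v| < d ->
    height u <= height v <= height u + e / 2.
  move=> u0 uv tu tv; rewrite height_mono//=; apply: height_step => // w /andP[uw wv].
  have tw : `|t - w| < d.
    by move: tu tv; rewrite !ltr_norml => /andP[? ?] /andP[? ?]; apply/andP; lra.
  have := metric_triangle (h u) (h t) (h w); have := hd _ tw; have := hd _ tu.
  by rewrite /= [mdist (h u) (h t)]metric_sym; lra.
exists d => //= s ts; rewrite in_itv /= => /andP[s0 _]; apply: eW => /=.
rewrite ltr_norml; have tt' : `|t - t| < d by rewrite subrr normr0.
have [st|st] := leP s t.
  have /andP[] := near s t s0 st ts tt'; lra.
have /andP[] := near t s t0 (ltW st) tt' ts; lra.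
Qed.

(** The section [p] of the rescaled height may jump, but [h \o p] does not depend on its choice, as
    [h] and [height] have the same fibres. It is injective for the same reason. *)
Lemma monotone_arc : h 0 <> h 1 -> exists f : R -> X,
  [/\ {within `[0, 1]%classic, continuous f},
    (forall s t, `[0, 1]%classic s -> `[0, 1]%classic t -> f s = f t -> s = t),
    f 0 = h 0, f 1 = h 1 & f @` `[0, 1]%classic `<=` h @` `[0, 1]%classic].
Proof.
move=> h01; pose L := height 1 - height 0.
have L0 : 0 < L.
  rewrite subr_gt0 lt_neqAle height_mono// andbT; apply/eqP => E; apply: h01.
  by apply/(height_eqP _ _ _).1 => //; rewrite ?lexx ?ler01.
have /choice[p hp] x : exists t, 0 <= x <= 1 ->
    (0 <= t <= 1) /\ height t = height 0 + x * L.
  have [/andP[x0 x1]|nx] := boolP (0 <= x <= 1); last by exists 0.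
  have [|t] := @IVT R height 0 1 (height 0 + x * L) ler01 height_continuous.
    have h01' : height 0 <= height 1 by rewrite height_mono.
    rewrite (min_idPl h01') (max_idPr h01') lerDl mulr_ge0 ?(ltW L0)//=.
    by rewrite -lerBrDl -/L ler_piMl// ltW.
  by rewrite in_itv /= => ht E; exists t.
have I (x : R) : `[0, 1]%classic x -> 0 <= x <= 1 by rewrite /= in_itv.
have hE u v : 0 <= u <= 1 -> 0 <= v <= 1 -> height u = height v <-> h u = h v.
  move=> /andP[u0 u1] /andP[v0 v1]; have [uv|/ltW vu] := leP u v.
    exact: height_eqP.
  have [h1 h2] := height_eqP v0 vu u1.
  by split=> E; apply/esym; [apply: h1|apply: h2].
have I0 : 0 <= (0 : R) <= 1 by rewrite lexx ler01.
have I1 : 0 <= (1 : R) <= 1 by rewrite lexx ler01.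
exists (h \o p); split.
- apply/cont_onP => x /I x01 W; have [px Ex] := hp x x01.
  rewrite nbhsE => -[B [oB Bx] BW].
  (* Continuity comes from compactness: the heights of parameters that [h] sends outside [B] form a
     closed set that misses the height in question. *)
  pose K := [set t | 0 <= t <= 1 /\ ~ B (h t)].
  have cK : compact K.
    have -> : K = `[0, 1]%classic `&` ~` (h @^-1` B).
      by apply/seteqP; split=> t /=; rewrite in_itv.
    apply: compact_closedI; first exact: segment_compact.
    apply: open_closedC; apply: open_comp => // t _; exact: ch.
  have cHK : closed (height @` K).
    apply: compact_closed; first exact: Rhausdorff.
    apply: continuous_compact => //; apply: continuous_subspaceW height_continuous.
    by move=> t [/= t01 _]; rewrite /= in_itv.
  have nx : nbhs (height 0 + x * L) (~` (height @` K)).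
    apply: open_nbhs_nbhs; split; first exact: closed_openC.
    by move=> [t [t01 nB]]; rewrite -Ex => /(hE _ _ t01 px) E; apply: nB; rewrite E.
  have cz : (fun z : R => height 0 + z * L) @ x --> height 0 + x * L.
    by apply: cvgD; [exact: cvg_cst|apply: cvgM; [exact: cvg_id|exact: cvg_cst]].
  apply: (@filterS _ _ (nbhs_filter x) _ _ _ (@cz _ nx)) => z /= nz /I z01; apply: BW.
  have [pz Ez] := hp z z01; apply: contrapT => nB; apply: nz.
  by exists (p z).
- move=> s t /I s01 /I t01 /= E; have [ps Es] := hp s s01; have [pt Et] := hp t t01.
  have := (hE _ _ ps pt).2 E; rewrite Es Et => /addrI/mulIf; apply.
  by rewrite gt_eqF.
- have [p0 E0] := hp 0 I0; apply/(hE _ _ p0 I0).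
  by rewrite E0 mul0r addr0.
- have [p1 E1] := hp 1 I1; apply/(hE _ _ p1 I1).
  by rewrite E1 mul1r addrC subrK.
- by move=> _ [t /I /hp[pt _] <-]; exists (p t).
Qed.
End MonotoneReparametrisation.

Lemma closed_max (R : realType) (A : set R) x0 c : closed A -> A x0 ->
  (forall x, A x -> x <= c) -> exists2 m, A m & forall x, A x -> x <= m.
Proof.
move=> cA Ax Ac; have hA : has_ubound A by exists c.
exists (sup A); last by move=> x; exact: ub_le_sup.
by apply: cA; apply: closure_sup => //; exists x0.
Qed.

Lemma closed_min (R : realType) (A : set R) x0 c : closed A -> A x0 ->
  (forall x, A x -> c <= x) -> exists2 m, A m & forall x, A x -> m <= x.
Proof.
move=> cA Ax Ac.
have cB : closed (-%R @^-1` A).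
  by apply: closed_comp => // x _; exact: opp_continuous.
have [|x hx|m Am hm] := @closed_max R (-%R @^-1` A) (- x0) (- c) cB.
- by rewrite /= opprK.
- by rewrite lerNr; exact: Ac.
- by exists (- m) => // x Ax'; rewrite lerNl; apply: hm; rewrite /= opprK.
Qed.

(** * Collapsing loops to obtain interval fibres *)

Section MonotonePath.
Variables (R : realType) (X : metricType R) (g : R -> X).
Hypothesis cg : continuous g.

(* Components of Q on whose two end points g agrees can be collapsed. *)
Definition collapsible (Q : set R) := [/\ open Q, Q `<=` `]0, 1[%classic &
  forall s t, 0 <= s -> s < t -> t <= 1 -> ~ Q s -> ~ Q t ->
    (forall u, s < u -> u < t -> Q u) -> g s = g t].

(** For a chain under inclusion, a compact interval inside a component of the union lies in one
    member [Q]. The component of [Q] around it has ends close to [s] and [t] with equal [g]-values,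
    so [g s] and [g t] are arbitrarily close. *)
Lemma collapsible_bigcup (C : set (set R)) : C `<=` collapsible ->
  total_on C subset -> collapsible (\bigcup_(Q in C) Q).
Proof.
move=> hC tC; split.
- by apply: bigcup_open => Q /hC[].
- by move=> x [Q /hC[_ + _]]; apply.
move=> s t s0 st t1 ns nt hst; apply: contrapT => /eqP; rewrite -mdist_gt0.
set e := mdist _ _ => e0.
have e2 : 0 < e / 2 by rewrite divr_gt0.
have [ds ds0 hs] := cont_mdist cg s e2.
have [dt dt0 ht] := cont_mdist cg t e2.
(* A third keeps the margins [[s, s + d]] and [[t - d, t]] disjoint with a nonempty interval between
   them. *)
pose d := Num.min (Num.min ds dt) (t - s) / 3.
have d0 : 0 < d by rewrite divr_gt0// !lt_min ds0 dt0 subr_gt0.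
have [dds ddt dts] : [/\ d < ds, d < dt & 3 * d <= t - s].
  have h (x : R) : 0 < x -> x / 3 < x by lra.
  have m1 : Num.min (Num.min ds dt) (t - s) <= ds by rewrite !ge_min lexx.
  have m2 : Num.min (Num.min ds dt) (t - s) <= dt by rewrite !ge_min lexx orbT.
  have m3 : Num.min (Num.min ds dt) (t - s) <= t - s by rewrite !ge_min lexx !orbT.
  by split; rewrite /d in d0 *; lra.
clearbody d.
have [Q CQ hQ] : exists2 Q, C Q & forall u, s + d <= u -> u <= t - d -> Q u.
  have [|l [hl lK]] := @compact_finite_cover R^o `[s + d, t - d]%classic C
      (@segment_compact R (s + d) (t - d)).
    move=> u; rewrite /= in_itv /= => /andP[su ut].
    have [||Q CQ Qu] := hst u; [by lra|by lra|].
    by exists Q; split=> //; have [] := hC _ CQ.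
  have [Q CQ hQ] : exists2 Q, C Q & forall B, List.In B l -> B `<=` Q.
    have [||Q0 CQ0 _] := hst (s + d); [by lra|by lra|].
    elim: l hl {lK} => [|B l IH] hl; first by exists Q0.
    have [|Q CQ hQ] := IH; first by move=> B' hB'; apply: hl; right.
    have [_ CB] := hl B (or_introl erefl).
    have [QB|BQ] := tC _ _ CQ CB; last by exists Q => // B' [<-|/hQ].
    by exists B => // B' [<-//|/hQ h]; exact: subset_trans h QB.
  exists Q => // u su ut; have [|B Bl Bu] := lK u; last exact: hQ Bu.
  by rewrite /= in_itv /= su.
have [oQ Q01 gQ] := hC _ CQ.
have nQ x : ~ (\bigcup_(B in C) B) x -> ~ Q x by move=> h Qx; apply: h; exists Q.
have [s1 [ss1 s1d ns1] hs1] : exists2 s1, [/\ s <= s1, s1 <= s + d & ~ Q s1] &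
    forall x, [/\ s <= x, x <= s + d & ~ Q x] -> x <= s1.
  apply: (@closed_max R [set x | [/\ s <= x, x <= s + d & ~ Q x]] s (s + d)).
  - have -> : [set x | [/\ s <= x, x <= s + d & ~ Q x]] =
        `[s, s + d]%classic `&` ~` Q.
      apply/seteqP; split=> x /=; rewrite in_itv /=.
        by move=> [-> ->].
      by move=> [/andP[]].
    apply: closedI; first exact: itv_closed.
    exact: open_closedC.
  - by split; [exact: lexx|rewrite lerDl ltW|exact: nQ].
  - by move=> x [].
have [t1' [t1t t1d nt1] ht1] : exists2 t1, [/\ t1 <= t, t - d <= t1 & ~ Q t1] &
    forall x, [/\ x <= t, t - d <= x & ~ Q x] -> t1 <= x.
  apply: (@closed_min R [set x | [/\ x <= t, t - d <= x & ~ Q x]] t (t - d)).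
  - have -> : [set x | [/\ x <= t, t - d <= x & ~ Q x]] =
        `[t - d, t]%classic `&` ~` Q.
      apply/seteqP; split=> x /=; rewrite in_itv /=.
        by move=> [-> ->].
      by move=> [/andP[]].
    apply: closedI; first exact: itv_closed.
    exact: open_closedC.
  - by split; [exact: lexx|rewrite lerBlDr lerDl ltW|exact: nQ].
  - by move=> x [].
have E : g s1 = g t1'.
  apply: gQ => //; [lra|lra|lra|] => u s1u ut1; apply: contrapT => nu.
  have [us|su] := leP u (s + d).
    have : u <= s1 by apply: hs1; split=> //; lra.
    by lra.
  have [tu|ut] := leP (t - d) u.
    have : t1' <= u by apply: ht1; split=> //; lra.
    by lra.
  by apply: nu; apply: hQ; lra.
have h1 : mdist (g s) (g s1) < e / 2.
  by apply: hs; rewrite distrC ger0_norm ?subr_ge0//; lra.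
have h2 : mdist (g t) (g t1') < e / 2.
  by apply: ht; rewrite ger0_norm ?subr_ge0//; lra.
have := metric_triangle (g s) (g s1) (g t).
rewrite E [mdist (g t1') (g t)]metric_sym -/e => h3.
by rewrite E in h1; lra.
Qed.

(** If [g s = g t] with both ends outside [Q], adding []s, t[] preserves collapsibility: [s] and [t]
    stay outside, so a component of the union meeting []s, t[] equals it. Maximality then forces
    []s, t[] into [Q]. *)
Lemma maximal_collapsible : exists2 Q, collapsible Q &
  forall s t, 0 <= s -> s < t -> t <= 1 -> ~ Q s -> ~ Q t -> g s = g t ->
    forall u, s < u -> u < t -> Q u.
Proof.
have [Q [hQ mQ]] := Zorn_bigcup (@collapsible_bigcup).
exists Q => // s t s0 st t1 ns nt gst.
have [oQ Q01 gQ] := hQ.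
pose Q' := Q `|` `]s, t[%classic.
suff hQ' : collapsible Q'.
  move=> u su ut; apply: contrapT => nu; apply: (mQ Q') hQ'; split.
    by move=> x; left.
  by move=> /(_ u) h; apply/nu/h; right; rewrite /= in_itv /= su.
split.
- by apply: openU => //; exact: itv_open.
- move=> x [/Q01//|]; rewrite /= !in_itv /= => /andP[sx xt].
  by rewrite (le_lt_trans s0 sx) (lt_le_trans xt t1).
- move=> s' t' s0' st' t1' ns' nt' h.
  have [nQs ns1] : ~ Q s' /\ ~ (s < s' < t).
    by split=> k; apply: ns'; [left|right; rewrite /= in_itv].
  have [nQt nt1] : ~ Q t' /\ ~ (s < t' < t).
    by split=> k; apply: nt'; [left|right; rewrite /= in_itv].
  have [meet|nmeet] := EM (exists u, [/\ s' < u, u < t', s < u & u < t]); last first.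
    apply: gQ => // u su ut; have [//|] := h u su ut; rewrite /= in_itv /= => /andP[? ?].
    by case: nmeet; exists u.
  have [u [su ut su' ut']] := meet.
  have nQ x : ~ Q x -> ~ (s < x < t) -> ~ Q' x.
    by move=> nx nx' [//|]; rewrite /= in_itv.
  have ss : s' = s.
    apply/eqP; rewrite eq_le; apply/andP; split; rewrite leNgt; apply/negP => ss'.
      by apply: ns1; rewrite ss' (lt_trans su).
    have : Q' s by apply: h => //; exact: lt_trans ut.
    by apply: nQ => //; rewrite ltxx.
  have tt : t' = t.
    apply/eqP; rewrite eq_le; apply/andP; split; rewrite leNgt; apply/negP => tt'.
      have : Q' t by apply: h => //; exact: lt_trans ut'.
      by apply: nQ => //; rewrite ltxx andbF.
    by apply: nt1; rewrite tt' (lt_trans su').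
  by rewrite ss tt.
Qed.

Lemma monotone_path : exists h : R -> X,
  [/\ {within `[0, 1]%classic, continuous h},
    (forall s u t, 0 <= s -> s <= u -> u <= t -> t <= 1 -> h s = h t -> h u = h s),
    h 0 = g 0, h 1 = g 1 & h @` `[0, 1]%classic `<=` g @` `[0, 1]%classic].
Proof.
have [Q [oQ Q01 gQ] mQ] := maximal_collapsible.
have nQ0 : ~ Q 0 by move=> /Q01; rewrite /= in_itv /= ltxx.
have nQ1 : ~ Q 1 by move=> /Q01; rewrite /= in_itv /= ltxx andbF.
have cQ a b : closed [set x | [/\ a <= x, x <= b & ~ Q x]].
  have -> : [set x | [/\ a <= x, x <= b & ~ Q x]] = `[a, b]%classic `&` ~` Q.
    apply/seteqP; split=> x /=; rewrite in_itv /=; first by move=> [-> ->].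
    by move=> [/andP[]].
  by apply: closedI; [exact: itv_closed|exact: open_closedC].
(* [l t] is the last point up to [t] outside [Q]; the collapsed path is [g \o l]. *)
have /choice[l hl] t : exists l, 0 <= t <= 1 ->
    [/\ 0 <= l, l <= t, ~ Q l & forall u, l < u -> u <= t -> Q u].
  have [/andP[t0 t1]|nt] := boolP (0 <= t <= 1); last by exists 0.
  have [||l [l0 lt nl] hl] := @closed_max R _ 0 t (@cQ 0 t); first by split.
    by move=> x [].
  exists l => _; split=> // u lu ut; apply: contrapT => nu.
  by have := hl u; rewrite leNgt lu => h; have : false by apply: h; split=> //; lra.
have hr t : 0 <= t <= 1 -> exists r, [/\ t <= r, r <= 1, ~ Q r & forall u, t <= u -> u < r -> Q u].
  move=> /andP[t0 t1].
  have [||r [tr r1 nr] hr] := @closed_min R _ 1 t (@cQ t 1); first by split.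
    by move=> x [].
  exists r; split=> // u tu ur; apply: contrapT => nu.
  by have := hr u; rewrite leNgt ur => h; have : false by apply: h; split=> //; lra.
have lfix t : 0 <= t <= 1 -> ~ Q t -> l t = t.
  move=> t01 nt; have [l0 lt _ hlt] := hl t t01.
  by apply/eqP; rewrite eq_le lt leNgt; apply/negP => /hlt/(_ (lexx t)).
have lmono s t : 0 <= s -> s <= t -> t <= 1 -> l s <= l t.
  move=> s0 st t1; have [|l0 ls nl _] := hl s; first by rewrite s0 (le_trans st).
  have [|_ _ _ hlt] := hl t; first by rewrite t1 (le_trans s0).
  by rewrite leNgt; apply/negP => /hlt/(_ (le_trans ls st)).
(* [l] jumps across components of [Q], but [g] agrees at their ends. So any difference between
   [g (l s)] and [g (l t)] is already seen by [g] on [[s, t]], and continuity passes from [g] to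
   [g \o l]. *)
have between s t : 0 <= s -> s <= t -> t <= 1 ->
    g (l s) = g (l t) \/
    exists p q, [/\ s <= p <= t, s <= q <= t, g (l s) = g p & g (l t) = g q].
  move=> s0 st t1; have s01 : 0 <= s <= 1 by rewrite s0 (le_trans st).
  have t01 : 0 <= t <= 1 by rewrite t1 (le_trans s0).
  have [l0 ls nls hls] := hl s s01; have [lt0 lt nlt hlt] := hl t t01.
  have [r [sr r1 nr hrs]] := hr s s01.
  have grs : g (l s) = g r.
    have [lr|rl] := ltP (l s) r; last by congr g; lra.
    apply: gQ => // u lu ur; have [us|su] := leP u s; first exact: hls.
    by apply: hrs => //; exact: ltW.
  have [slt|lts] := leP s (l t).
    have rt : r <= t.
      by rewrite leNgt; apply/negP => tr; apply: nlt; apply: hrs => //; exact: le_lt_trans tr.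
    by right; exists r, (l t); rewrite sr rt slt lt.
  left; congr g; apply/eqP; rewrite eq_le lmono//= leNgt; apply/negP => h.
  by apply: nlt; apply: hls => //; exact: ltW.
exists (g \o l); split.
- apply/cont_onP => t; rewrite /= in_itv /= => /andP[t0 t1] W /nbhs_mdistP[e e0 eW].
  have [d d0 hd] := cont_mdist cg t (divr_gt0 e0 (ltr0Sn R 1)).
  exists d => //= s /= ts; rewrite in_itv /= => /andP[s0 s1]; apply: eW.
  have close p q : `|t - p| < d -> `|t - q| < d -> mdist (g p) (g q) < e.
    move=> /hd hp /hd hq; have := metric_triangle (g p) (g t) (g q).
    by rewrite [mdist (g p) (g t)]metric_sym; lra.
  have [st|/ltW st] := leP s t.
    have [-> /=|[p [q [/andP[sp pt] /andP[sq qt] /= -> ->]]]] := between s t s0 st t1.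
      by rewrite mdistxx.
    by apply: close; move: ts; rewrite !ltr_norml => /andP[? ?]; apply/andP; lra.
  have [-> /=|[p [q [/andP[sp pt] /andP[sq qt] /= -> ->]]]] := between t s t0 st s1.
    by rewrite mdistxx.
  by apply: close; move: ts; rewrite !ltr_norml => /andP[? ?]; apply/andP; lra.
- move=> s u t s0 su ut t1 /= E.
  have s01 : 0 <= s <= 1 by rewrite s0 (le_trans su)// (le_trans ut).
  have t01 : 0 <= t <= 1 by rewrite t1 (le_trans s0)// (le_trans su).
  have u01 : 0 <= u <= 1 by rewrite (le_trans s0 su) (le_trans ut).
  have [l0 ls nls hls] := hl s s01; have [lt0 lt nlt hlt] := hl t t01.
  have [lu0 lu nlu hlu] := hl u u01.
  have lsu : l s <= l u by apply: lmono => //; case/andP: u01.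
  have lut : l u <= l t by apply: lmono => //; case/andP: u01.
  move: lsu; rewrite le_eqVlt => /predU1P[->//|lsu].
  move: lut; rewrite le_eqVlt => /predU1P[->//|lut].
  (* A point [l u] strictly between two points outside [Q] with equal [g]-values would lie in [Q] by
     maximality. *)
  case: nlu; apply: (mQ (l s) (l t)) => //; first exact: lt_trans lut.
  exact: le_trans lt t1.
- by rewrite /= lfix// lexx ler01.
- by rewrite /= lfix// lexx ler01.
- move=> y [t /=]; rewrite in_itv /= => t01 <-.
  have [l0 lt _ _] := hl t t01; exists (l t) => //=.
  by rewrite in_itv /= l0 (le_trans lt)//; case/andP: t01.
Qed.
End MonotonePath.

Section ArcFromPath.
Variables (R : realType) (X : metricType R).

(** Clamping the parameter to [[0, 1]] replaces relative continuity by continuity on the whole line,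
    as the preceding constructions assume. *)
Lemma continuous_extension (f : R -> X) : {within `[0, 1]%classic, continuous f} ->
  exists g : R -> X, [/\ continuous g, forall t, 0 <= t <= 1 -> g t = f t &
    range g `<=` f @` `[0, 1]%classic].
Proof.
move=> /cont_onP cf; pose c (t : R) := Num.max 0 (Num.min t 1).
have c01 t : `[0, 1]%classic (c t).
  by rewrite /= in_itv /= le_max lexx /= ge_max ler01 ge_min lexx orbT.
have cc : continuous c.
  move=> t; have c1 : {for t, continuous ((id : R -> R^o) \min cst 1)}.
    by apply: continuous_min; [exact: cvg_id|exact: cvg_cst].
  by apply: (continuous_max (f := cst 0) _ c1); exact: cvg_cst.
exists (f \o c); split.
- move=> t W /(cf _ (c01 t) W) /(@cc t) nW.
  by apply: (@filterS _ _ (nbhs_filter t) _ _ _ nW) => s; apply; exact: c01.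
- by move=> t /andP[t0 t1]; rewrite /= /c (min_idPl t1) (max_idPr t0).
- by move=> _ [t _ <-]; exists (c t).
Qed.

Lemma arc_of_path (A : set X) a b : a <> b -> path_in A a b -> exists f : R -> X,
  [/\ {within `[0, 1]%classic, continuous f},
    (forall s t, `[0, 1]%classic s -> `[0, 1]%classic t -> f s = f t -> s = t),
    f 0 = a, f 1 = b & f @` `[0, 1]%classic `<=` A].
Proof.
move=> ab [p [/continuous_extension[g [cg gp gA]] p0 p1 pA]].
have I0 : 0 <= (0 : R) <= 1 by rewrite lexx ler01.
have I1 : 0 <= (1 : R) <= 1 by rewrite lexx ler01.
have [k [/continuous_extension[h [ch hk hA]] mk k0 k1 kg]] := monotone_path cg.
have mh s u t : 0 <= s -> s <= u -> u <= t -> t <= 1 -> h s = h t -> h u = h s.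
  move=> s0 su ut t1; rewrite !hk; first exact: mk.
  - by rewrite (le_trans s0 su) (le_trans ut t1).
  - by rewrite (le_trans s0 (le_trans su ut)) t1.
  - by rewrite s0 (le_trans su (le_trans ut t1)).
have h0 : h 0 = a by rewrite hk// k0 gp.
have h1 : h 1 = b by rewrite hk// k1 gp.
have [|f [cf fi f0 f1 fh]] := monotone_arc ch mh; first by rewrite h0 h1.
exists f; split=> //; [by rewrite f0|by rewrite f1|].
move=> y /fh[t _ <-]; apply: pA; apply: gA.
have [s s01 <-] : (k @` `[0, 1]%classic) (h t) by apply: hA; exists t.
by have [|r _ <-] := kg (k s); [exists s|exists r].
Qed.
End ArcFromPath.

(** A cover of [A] becomes one of [M] by adding the complement of [A]. In the refinement only sets
    meeting [A] are kept, and these cannot have been refined from the added set. *)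
Lemma covdim_closed_sub (X : topologicalType) (M A : set X) m :
  closed A -> A `<=` M -> covdim_le M m -> covdim_le A m.
Proof.
move=> cA AM dM s os As.
have [||t [ot [Mt [ts tm]]]] := dM (~` A :: s).
- by move=> U [<-|/os//]; exact: closed_openC.
- move=> x Mx; have [/As[U Us Ux]|nAx] := EM (A x).
    by exists U => //; right.
  by exists (~` A) => //; left.
pose keep (V : set X) := `[< V `&` A !=set0 >].
have In_filter V : List.In V [seq V <- t | keep V] <-> List.In V t /\ keep V.
  elim: t {ot Mt ts tm} => [|W t IH] /=; first by split=> // -[].
  case: ifP => kW /=; rewrite IH.
    split=> [[<-|[]]|[[->|]]]; [by split; [left|]|by split; [right|]|by left|].
    by move=> Vt kV; right.
  split=> [[Vt kV]|[[WV kV|//]]]; first by split; [right|].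
  by rewrite -WV kW in kV.
exists [seq V <- t | keep V]; split; first by move=> V /In_filter[/ot].
split.
  move=> x Ax; have [V Vt Vx] := Mt _ (AM _ Ax); exists V => //.
  by apply/In_filter; split=> //; apply/asboolP; exists x.
split.
  move=> V /In_filter[Vt /asboolP[y [Vy Ay]]]; have [U [UA|Us] VU] := ts _ Vt.
    by have := VU y (conj Vy (AM _ Ay)); rewrite -UA.
  by exists U => // x [Vx /AM Mx]; exact: VU.
move=> x Ax; apply: le_trans (tm _ (AM _ Ax)); rewrite lez_nat count_filter.
by apply: sub_count => V /andP[].
Qed.

Theorem theorem4p3 (R : realType) (X : metricType R) (n : nat) (M : set X) :
  (1 <= n)%N ->
  complete_space X ->
  connected [set: X] ->
  locally_connected X ->
  property_H R X n.-1 ->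
  F_sigma M ->
  covdim_le M (n%:Z - 2) ->
  forall U : set X, open U -> connected U -> U `\` M !=set0 ->
    arcwise_connected R (U `\` M).
Proof.
move=> n1 cX _ lX hH [F [cF ->]] dM U oU cU _ x y Mx My xy.
apply: arc_of_path => //.
apply: (path_avoiding cX lX cF oU cU) => // i A W cA AF oW cW _.
apply: (nonseparating n1 hH cA _ oW); last exact: path_connected_open.
by apply: covdim_closed_sub dM => // z /AF; exists i.
Qed.
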